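(* Let $A \in \operatorname{Pd}(2n)$, with distinct symplectic eigenvalues $\mu_1<\cdots<\mu_r$ and associated index sets $\alpha_i$ ($1\le i\le r$), and let $H\in \operatorname{Sm}(2n)$ be such that $A + H \in \operatorname{Pd}(2n)$. Let $S\in \operatorname{Sp}(2n; A)$ and $\tilde{S} \in \operatorname{Sp}(2n; A+H)$ be arbitrary. Then there exists an orthosymplectic matrix $Q$ of the form $$Q=Q_{[1]}\oplus^{\operatorname{s}} \cdots \oplus^{\operatorname{s}} Q_{[r]},$$ where $Q_{[i]} \in \operatorname{OrSp}(2|\alpha_i|)$ for all $i=1,\ldots,r$, satisfying $$\tilde{S}=SQ+\mathcal{O}(\|H\|).$$
   Context: Notation. $\operatorname{Sm}(m)$ is the set of $m\times m$ real symmetric matrices; $\operatorname{Pd}(2n)\subset\operatorname{Sm}(2n)$ is the set of positive definite ones. $\|\cdot\|$ is the spectral norm (maximum singular value). $I_n$ is the $n\times n$ identity matrix and $J_{2n}=\begin{pmatrix}0&I_n\\ -I_n&0\end{pmatrix}$. A real $2n\times 2n$ matrix $S$ is symplectic if $S^TJ_{2n}S=J_{2n}$; $\operatorname{Sp}(2n)$ is the group of such matrices. $\operatorname{OrSp}(2n)$ is the set of orthosymplectic matrices, i.e. $2n\times2n$ real matrices that are both orthogonal and symplectic. Williamson's theorem: for every $A\in\operatorname{Pd}(2n)$ there is $S\in\operatorname{Sp}(2n)$ with $S^TAS=D\oplus D=\begin{pmatrix}D&0\\ 0&D\end{pmatrix}$, where $D$ is an $n\times n$ diagonal matrix with positive diagonal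 entries $d_1(A)\le\cdots\le d_n(A)$ (listed in this order), which do not depend on $S$ and are called the symplectic eigenvalues of $A$. $\operatorname{Sp}(2n;A)$ is the set of all $S\in\operatorname{Sp}(2n)$ with $S^TAS=D\oplus D$ for this $D=\operatorname{diag}(d_1(A),\ldots,d_n(A))$. Index sets: if $\mu_1<\cdots<\mu_r$ are the distinct symplectic eigenvalues of $A$, then $\alpha_i=\{j\in\{1,\ldots,n\}: d_j(A)=\mu_i\}$ for $i=1,\ldots,r$. Symplectic direct sum: for $T=\begin{pmatrix}W&X\\ Y&Z\end{pmatrix}$ with $m\times m$ blocks and $T'=\begin{pmatrix}W'&X'\\ Y'&Z'\end{pmatrix}$ with $m'\times m'$ blocks, $$T\oplus^{\operatorname{s}}T'=\begin{pmatrix}W\oplus W'&X\oplus X'\\ Y\oplus Y'&Z\oplus Z'\end{pmatrix},$$ where $\oplus$ is the usual (block diagonal) direct sum; this operation is associative. Big-O: $Y=\mathcal O(\|H\|)$ means that there exist positive scalars $c$ and $\delta$ such that $\|Y\|\le c\|H\|$ for all admissible $H$ (i.e. $H\in \operatorname{Sm}(2n)$ with $A+H\in\operatorname{Pd}(2n)$) with $\|H\|<\delta$. Here $A$ and $S$ are fixed, $H$ varies, $\tilde S$ is an arbitrary element of $\operatorname{Sp}(2n;A+H)$ for each $H$, and $Q$ may depend on $H$ and $\tilde S$. *)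

(* Defs.v *)
From HB Require Import structures.
From mathcomp Require Import all_boot all_order all_algebra.
From mathcomp Require Import all_classical all_reals.

Set Implicit Arguments.
Unset Strict Implicit.
Unset Printing Implicit Defensive.

Import Order.TTheory GRing.Theory Num.Theory.

Local Open Scope classical_set_scope.
Local Open Scope ring_scope.

(* Matrices of even size 2n are typed 'M_(n + n), so that their four n x n
   blocks are those of block_mx. *)

Section SymplecticMatrices.
Variable R : realType.

Definition posdef_mx m (A : 'M[R]_m) : Prop :=
  A^T = A /\ forall x : 'cV[R]_m, x != 0 -> 0 < (x^T *m A *m x) 0 0.

Definition singular_value m (M : 'M[R]_m) (s : R) : Prop :=
  0 <= s /\ eigenvalue (M^T *m M) (s ^+ 2).

(* The set of singular values is finite, and nonempty for m > 0, so that the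
   supremum is a maximum; for m = 0 it is sup set0 = 0. *)
Definition spectral_norm m (M : 'M[R]_m) : R := sup [set s | singular_value M s].

Definition sympJ n : 'M[R]_(n + n) := block_mx 0 1%:M (- 1%:M) 0.

Definition symplectic_mx n (S : 'M[R]_(n + n)) : Prop :=
  S^T *m sympJ n *m S = sympJ n.

Definition orthosymplectic_mx n (Q : 'M[R]_(n + n)) : Prop :=
  Q^T *m Q = 1%:M /\ symplectic_mx Q.

Definition dsum_mx m m' (M : 'M[R]_m) (M' : 'M[R]_m') : 'M[R]_(m + m') :=
  block_mx M 0 0 M'.

Definition williamson_diag n (A : 'M[R]_(n + n)) (d : 'rV[R]_n) : Prop :=
  [/\ forall j, 0 < d 0 j,
      forall j k : 'I_n, (j <= k)%N -> d 0 j <= d 0 k &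
      exists S : 'M[R]_(n + n), symplectic_mx S /\
        S^T *m A *m S = dsum_mx (diag_mx d) (diag_mx d)].

(* For A positive definite, Williamson's theorem says that exactly one d
   satisfies williamson_diag A d; the default value 0 is then never taken. *)
Definition symp_eigs n (A : 'M[R]_(n + n)) : 'rV[R]_n :=
  xget 0 [set d | williamson_diag A d].

(* The set Sp(2n; A). *)
Definition diagonalizing_symp n (A S : 'M[R]_(n + n)) : Prop :=
  symplectic_mx S /\
  S^T *m A *m S = dsum_mx (diag_mx (symp_eigs A)) (diag_mx (symp_eigs A)).

Definition distinct_symp_eigs n (A : 'M[R]_(n + n)) : seq R :=
  sort <=%R (undup [seq symp_eigs A 0 j | j <- enum 'I_n]).

Definition num_symp_eigs n (A : 'M[R]_(n + n)) : nat :=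
  size (distinct_symp_eigs A).

Definition index_set n (A : 'M[R]_(n + n)) (i : 'I_(num_symp_eigs A)) :
    {set 'I_n} :=
  [set j | symp_eigs A 0 j == (distinct_symp_eigs A)`_i]%SET.

Definition symp_dsum m m' (T : 'M[R]_(m + m)) (T' : 'M[R]_(m' + m')) :
    'M[R]_((m + m') + (m + m')) :=
  block_mx (dsum_mx (ulsubmx T) (ulsubmx T')) (dsum_mx (ursubmx T) (ursubmx T'))
           (dsum_mx (dlsubmx T) (dlsubmx T')) (dsum_mx (drsubmx T) (drsubmx T')).

(* T_1 (+)^s (T_2 (+)^s ( ... (+)^s T_r)) for a list of matrices of various
   sizes; the final operand is the 0 x 0 matrix, which is neutral. *)
Fixpoint symp_dsum_seq (s : seq {m : nat & 'M[R]_(m + m)}) :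
    'M[R]_(sumn [seq tag T | T <- s] + sumn [seq tag T | T <- s]) :=
  match s with
  | [::] => 0
  | T :: s' => symp_dsum (tagged T) (symp_dsum_seq s')
  end.

Definition block_family n (A : 'M[R]_(n + n))
    (Q : forall i : 'I_(num_symp_eigs A),
       'M[R]_(#|index_set i| + #|index_set i|)) :
    seq {m : nat & 'M[R]_(m + m)} :=
  [seq existT (fun m => 'M[R]_(m + m)) #|index_set i| (Q i)
     | i <- enum 'I_(num_symp_eigs A)].

Lemma sum_card_index_set n (A : 'M[R]_(n + n)) :
  (\sum_(i < num_symp_eigs A) #|index_set i|)%N = n.
Proof.
have memD j : symp_eigs A 0 j \in distinct_symp_eigs A.
  by rewrite mem_sort mem_undup map_f // mem_enum.
have uD : uniq (distinct_symp_eigs A) by rewrite sort_uniq undup_uniq.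
pose f j : 'I_(num_symp_eigs A) :=
  Ordinal (etrans (index_mem _ _) (memD j)).
rewrite -[RHS]card_ord -sum1_card (partition_big f xpredT) //=.
apply: eq_bigr => i _; rewrite sum1dep_card cardsE.
apply: eq_card => j; rewrite !inE -val_eqE /=.
apply/eqP/eqP => [->|<-]; first by rewrite index_uniq.
by rewrite nth_index.
Qed.

Lemma size_block_family n (A : 'M[R]_(n + n))
    (Q : forall i : 'I_(num_symp_eigs A),
       'M[R]_(#|index_set i| + #|index_set i|)) :
  (sumn [seq tag T | T <- block_family Q] +
   sumn [seq tag T | T <- block_family Q] = n + n)%N.
Proof.
suff -> : sumn [seq tag T | T <- block_family Q] = n by [].
by rewrite -map_comp sumnE big_map big_enum /= sum_card_index_set.
Qed.

Definition symp_block_dsum n (A : 'M[R]_(n + n))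
    (Q : forall i : 'I_(num_symp_eigs A),
       'M[R]_(#|index_set i| + #|index_set i|)) : 'M[R]_(n + n) :=
  castmx (size_block_family Q, size_block_family Q)
    (symp_dsum_seq (block_family Q)).

End SymplecticMatrices.

(* Main.v *)
Require Import Defs.
From mathcomp Require Import all_boot all_order all_fingroup all_algebra.
From mathcomp Require Import all_classical all_reals.
From mathcomp Require Import spectral complex.
From mathcomp Require Import ring lra.
Import Order.TTheory GRing.Theory Num.Theory.

Set Implicit Arguments.
Unset Strict Implicit.
Unset Printing Implicit Defensive.

Local Open Scope ring_scope.

(** Put M = S^(-1) S~ and E = S^T H S, so that M is symplectic, E = O(|H|), and
    M^T (D (+) D + E) M = D' (+) D', where d and d' list the symplectic
    eigenvalues of A and A + H.  It is enough to find Q with M = Q + O(|E|).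

    Because M is symplectic, the congruence is the linear equation
    J (D (+) D + E) M = M J (D' (+) D') ([intertwine]).  It bounds d', hence M
    ([perturbed_bounded]), so that up to an error O(|E|) the matrix M intertwines
    J (D (+) D) with J (D' (+) D').  In terms of the blocks W, X, Y, Z of M this is
    a family of scalar systems, whose solution is W - Z = O(|E|), X + Y = O(|E|)
    and (d_i - d'_j) M_ij = O(|E|) in each block ([perturbed_entries]).  In other
    words M nearly commutes with J, that is, it is nearly the complex matrix
    W + iX, and its entries are small where d_i and d'_j are apart.

    The same estimate shows that d'_j is close to d_j with the same rank j: else M
    would be small on a rectangle with too many rows and columns, by the ordering
    of d and d', contradicting |det M| = 1 ([perturbed_eig_close]).  Hence the
    entries of W and X with d_i <> d_j are O(|E|).  Erasing them, and replacing Y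
    and Z by - X and W, yields G = M + O(|E|) which commutes with J; then
    M^T J M = J gives G^T G = 1 + O(|E|) ([perturbed_truncation]).

    As the eigenvalues are sorted, the index sets are consecutive intervals, and G
    is a symplectic direct sum over them ([class_block_decomposition]).  Each
    summand is an almost unitary complex matrix, and its unitary polar factor is
    within O(|E|) of it ([near_unitary], [near_orthosymplectic]).  The symplectic
    direct sum of these factors is Q.

    The estimates use the sum of the absolute values of the entries as norm; it is
    equivalent to the spectral norm by [spectral_norm_le] and
    [l1norm_le_spectral_norm]. *)

(** * An entrywise matrix norm *)

Section EntrywiseNorm.
Variable R : numDomainType.

(** Any norm will do for a statement about O-constants; this one is chosen
    because it is submultiplicative and additive over blocks, and because its
    relation to the entries needs no constant in one direction. *)
Definition l1norm m n (M : 'M[R]_(m, n)) : R := \sum_i \sum_j `|M i j|.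

Lemma l1norm_ge0 m n (M : 'M[R]_(m, n)) : 0 <= l1norm M.
Proof. by apply: sumr_ge0 => i _; apply: sumr_ge0. Qed.

Lemma le_entry_l1norm m n (M : 'M[R]_(m, n)) i j : `|M i j| <= l1norm M.
Proof.
rewrite /l1norm (bigD1 i) //= (bigD1 j) //= -addrA lerDl addr_ge0 ?sumr_ge0 //.
by move=> k _; apply: sumr_ge0.
Qed.

Lemma l1norm_gt0 m n (M : 'M[R]_(m, n)) : M != 0 -> 0 < l1norm M.
Proof.
move=> M0; rewrite lt_def l1norm_ge0 andbT; apply: contraNneq M0 => n0.
apply/eqP/matrixP => i j; apply/eqP; rewrite mxE -normr_le0 -n0.
exact: le_entry_l1norm.
Qed.

Lemma l1norm_le m n (M : 'M[R]_(m, n)) (b : R) :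
  (forall i j, `|M i j| <= b) -> l1norm M <= (m * n)%:R * b.
Proof.
move=> hb; apply: (@le_trans _ _ (\sum_(i < m) \sum_(j < n) b)).
  by apply: ler_sum => i _; apply: ler_sum.
by rewrite !sumr_const !card_ord -mulrnA mulnC mulr_natl.
Qed.

Lemma l1normD m n (M M' : 'M[R]_(m, n)) : l1norm (M + M') <= l1norm M + l1norm M'.
Proof.
rewrite -big_split; apply: ler_sum => i _; rewrite -big_split /=.
by apply: ler_sum => j _; rewrite mxE ler_normD.
Qed.

Lemma l1normN m n (M : 'M[R]_(m, n)) : l1norm (- M) = l1norm M.
Proof. by apply: eq_bigr => i _; apply: eq_bigr => j _; rewrite mxE normrN. Qed.

Lemma l1normB m n (M M' : 'M[R]_(m, n)) : l1norm (M - M') <= l1norm M + l1norm M'.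
Proof. by rewrite -(l1normN M') l1normD. Qed.

Lemma l1normM m n p (M : 'M[R]_(m, n)) (M' : 'M[R]_(n, p)) :
  l1norm (M *m M') <= l1norm M * l1norm M'.
Proof.
rewrite [leRHS]mulr_suml; apply: ler_sum => i _; rewrite mulr_suml.
under [leLHS]eq_bigr do rewrite mxE.
apply: (@le_trans _ _ (\sum_j \sum_k `|M i k| * `|M' k j|)).
  apply: ler_sum => j _; apply: le_trans (ler_norm_sum _ _ _) _.
  by apply: ler_sum => k _; rewrite normrM.
rewrite exchange_big /=; apply: ler_sum => k _; rewrite -mulr_sumr.
apply: ler_wpM2l => //; rewrite /l1norm (bigD1 k) //= lerDl sumr_ge0 // => l _.
exact: sumr_ge0.
Qed.

Lemma l1norm_mul_le m n p (M : 'M[R]_(m, n)) (M' : 'M[R]_(n, p)) (b b' : R) :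
  l1norm M <= b -> l1norm M' <= b' -> l1norm (M *m M') <= b * b'.
Proof.
by move=> hb hb'; apply: le_trans (l1normM _ _) (ler_pM _ _ hb hb');
  exact: l1norm_ge0.
Qed.

Lemma l1norm_tr m n (M : 'M[R]_(m, n)) : l1norm M^T = l1norm M.
Proof.
rewrite /l1norm exchange_big; apply: eq_bigr => i _; apply: eq_bigr => j _.
by rewrite mxE.
Qed.

Lemma l1norm0 m n : l1norm (0 : 'M[R]_(m, n)) = 0.
Proof. by rewrite /l1norm big1 // => i _; rewrite big1 // => j _; rewrite mxE normr0. Qed.

Lemma l1norm_block m1 m2 n1 n2 (P : 'M[R]_(m1, n1)) (Q : 'M[R]_(m1, n2))
    (S : 'M[R]_(m2, n1)) (T : 'M[R]_(m2, n2)) :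
  l1norm (block_mx P Q S T) = l1norm P + l1norm Q + l1norm S + l1norm T.
Proof.
rewrite /l1norm big_split_ord /= -addrA; congr (_ + _); rewrite -big_split;
  apply: eq_bigr => i _; rewrite big_split_ord; congr (_ + _);
  by apply: eq_bigr => j _;
    rewrite ?block_mxEul ?block_mxEur ?block_mxEdl ?block_mxEdr.
Qed.

End EntrywiseNorm.

(** * Unitary matrices near an almost unitary matrix *)

Section Complex.
Variable C : numClosedFieldType.
Local Open Scope sesquilinear_scope.

Lemma l1norm_trC m n (M : 'M[C]_(m, n)) : l1norm (M^t*) = l1norm M.
Proof.
rewrite -[RHS]l1norm_tr; apply: eq_bigr => i _; apply: eq_bigr => j _.
by rewrite mxE norm_conjC.
Qed.

Lemma trC_mul m n p (M : 'M[C]_(m, n)) (M' : 'M[C]_(n, p)) :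
  (M *m M')^t* = M'^t* *m M^t*.
Proof. by rewrite trmx_mul map_mxM. Qed.

Lemma l1norm_unitary m (V : 'M[C]_m) : V \is unitarymx ->
  l1norm V <= (m * m)%:R.
Proof.
move=> /unitarymxP VV; rewrite -[leRHS]mulr1; apply: l1norm_le => i j.
rewrite -(@expr_le1 _ 2) //.
have /matrixP/(_ i i) := VV; rewrite !mxE eqxx /= mulr1n => <-.
rewrite (bigD1 j) //= !mxE -normCK lerDl sumr_ge0 // => k _.
by rewrite !mxE mul_conjC_ge0.
Qed.

Lemma hermitian_diagonalization m (G : 'M[C]_m) : G^t* = G ->
  exists (V : 'M[C]_m) (l : 'rV[C]_m),
    [/\ V \is unitarymx, V^t* *m V = 1%:M, forall k, l 0 k \is Num.real &
     G = V^t* *m diag_mx l *m V].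
Proof.
move=> hG; have hH : G \is hermsymmx.
  by apply/is_hermitianmxP; rewrite expr0 scale1r hG.
exists (spectralmx G), (spectral_diag G); split.
- exact: spectral_unitarymx.
- by rewrite -invmx_unitary ?spectral_unitarymx // mulVmx ?spectral_unit.
- by move=> k; have /mxOverP := hermitian_spectral_diag_real hH; apply.
- rewrite -invmx_unitary ?spectral_unitarymx //.
  exact/orthomx_spectralP/hermitian_normalmx.
Qed.

(** Polar decomposition.  Write the Gram matrix of [U] as V* diag(l) V with V
    unitary.  If it is close to 1 then so are the l_k, hence they are positive
    and Q = U V* diag(l^(-1/2)) V is unitary.  Moreover
    U - Q = Q V* (diag(l^(1/2)) - 1) V, and |sqrt l - 1| <= |l - 1| makes the
    distance linear, not merely square-root small, in the defect of the Gram
    matrix. *)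
Lemma near_unitary m (U : 'M[C]_m) :
  (m * m)%:R ^+ 2 * l1norm (U^t* *m U - 1%:M) < 1 ->
  exists Q : 'M[C]_m, Q^t* *m Q = 1%:M /\
    l1norm (U - Q) <= (m * m)%:R ^+ 5 * l1norm (U^t* *m U - 1%:M).
Proof.
set G := U^t* *m U => small.
have hG : G^t* = G by rewrite trC_mul trmxCK.
have [V [l [uV VV lreal GE]]] := hermitian_diagonalization hG.
have /unitarymxP VV' := uV.
have lE : diag_mx l - 1%:M = V *m (G - 1%:M) *m V^t*.
  by rewrite GE mulmxBr mulmxBl !mulmxA VV' mul1mx -mulmxA VV' !mulmx1 VV'.
have nV := l1norm_unitary uV.
have nl : l1norm (diag_mx l - 1%:M) <= (m * m)%:R ^+ 2 * l1norm (G - 1%:M).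
  rewrite lE expr2 -mulrA [_ * l1norm _]mulrC mulrA.
  apply: l1norm_mul_le; last by rewrite l1norm_trC.
  exact: l1norm_mul_le.
have lgt0 k : 0 < l 0 k.
  have : `|l 0 k - 1| < 1.
    apply: le_lt_trans small; apply: le_trans nl.
    by have := le_entry_l1norm (diag_mx l - 1%:M) k k; rewrite !mxE eqxx mulr1n.
  rewrite real_ltr_norml ?rpredB ?rpred1 // => /andP[].
  by rewrite ltrBrDr addNr.
pose s : 'rV[C]_m := \row_k sqrtC (l 0 k).
pose s' : 'rV[C]_m := \row_k (sqrtC (l 0 k))^-1.
have sgt0 k : 0 < sqrtC (l 0 k) by rewrite sqrtC_gt0.
have ss' : diag_mx s' *m diag_mx s = 1%:M.
  rewrite mulmx_diag -diag_const_mx; congr diag_mx.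
  by apply/rowP => k; rewrite !mxE mulVf // gt_eqF.
have s'ls' : diag_mx s' *m diag_mx l *m diag_mx s' = 1%:M.
  rewrite !mulmx_diag -diag_const_mx; congr diag_mx.
  apply/rowP => k; rewrite !mxE -{2}(sqrtCK (l 0 k)).
  by have := sgt0 k; move: (sqrtC _) => x x0; field; rewrite gt_eqF.
have s'J : (diag_mx s')^t* = diag_mx s'.
  apply/matrixP => i j; rewrite !mxE; case: eqVneq => [->|ne]; last first.
    by rewrite !mulr0n rmorph0.
  by rewrite !mulr1n; apply/CrealP; rewrite rpredV ger0_real // ltW.
pose Q := U *m V^t* *m diag_mx s' *m V.
have QQ : Q^t* *m Q = 1%:M.
  rewrite /Q !trC_mul s'J trmxCK !mulmxA.
  rewrite -[_ *m U^t* *m U]mulmxA -/G GE !mulmxA.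
  rewrite -[_ *m V *m V^t*]mulmxA VV' mulmx1.
  rewrite -[_ *m V *m V^t*]mulmxA VV' mulmx1.
  by rewrite -[V^t* *m _ *m _ *m _]mulmxA -!mulmxA [diag_mx s' *m _]mulmxA
    [diag_mx s' *m _ *m (_ *m _)]mulmxA s'ls' mul1mx.
exists Q; split=> //.
have uQ : Q \is unitarymx.
  by rewrite -trmxC_unitary; apply/unitarymxP; rewrite trmxCK.
have UE : U = Q *m V^t* *m diag_mx s *m V.
  rewrite /Q -[_ *m V *m V^t*]mulmxA VV' mulmx1 -[_ *m _ *m diag_mx s]mulmxA ss'.
  by rewrite mulmx1 -mulmxA VV mulmx1.
have -> : U - Q = Q *m V^t* *m (diag_mx s - 1%:M) *m V.
  by rewrite mulmxBr mulmxBl -UE mulmx1 -[Q *m _ *m V]mulmxA VV mulmx1.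
have ns : l1norm (diag_mx s - 1%:M) <= l1norm (diag_mx l - 1%:M).
  apply: ler_sum => i _; apply: ler_sum => j _; rewrite !mxE.
  case: eqVneq => [->|ne]; last by rewrite !mulr0n subrr.
  rewrite !mulr1n -{2}(sqrtCK (l 0 j)) -[X in _ <= `|_ - X|](expr1n _ 2).
  rewrite subr_sqr normrM ler_peMr //.
  by rewrite ger0_norm ?lerDr ?addr_ge0 // ltW.
apply: (@le_trans _ _ ((m * m)%:R * (m * m)%:R *
     ((m * m)%:R ^+ 2 * l1norm (G - 1%:M)) * (m * m)%:R)); last first.
  by rewrite le_eqVlt; apply/orP; left; apply/eqP; ring.
do 2!apply: l1norm_mul_le => //; last exact: le_trans ns nl.
apply: l1norm_mul_le; first exact: l1norm_unitary.
by rewrite l1norm_trC.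
Qed.

End Complex.

(** * Complex matrices as real block matrices *)

Section Realification.
Variable R : realType.
Local Notation C := (complex R).
Local Notation toC := (real_complex R).
Local Notation re := (@complex.Re R).
Local Notation im := (@complex.Im R).
Local Open Scope sesquilinear_scope.

Lemma ReD : {morph re : x y / x + y}. Proof. by case=> ? ? []. Qed.
Lemma ImD : {morph im : x y / x + y}. Proof. by case=> ? ? []. Qed.

(** W + iX is sent to the real matrix with blocks W, X, -X, W.  With this choice
    of signs iI is sent to J, so that the image is the commutant of J and the
    unitary matrices are sent onto the orthosymplectic ones. *)
Definition realification m n (Z : 'M[C]_(m, n)) : 'M[R]_(m + m, n + n) :=
  block_mx (map_mx re Z) (map_mx im Z) (- map_mx im Z) (map_mx re Z).

Lemma conjE (z : C) : Num.conj z = complex.Complex (re z) (- im z).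
Proof.
rewrite {1}[z]complexE rmorphD rmorphM /= complexiE conjCi.
have rJ (x : R) : Num.conj (toC x) = toC x.
  by apply/CrealP; rewrite complex_real.
rewrite !rJ -complexiE; apply/eqP; rewrite eq_complex /=; apply/andP.
by split; apply/eqP; ring.
Qed.

Lemma realificationM m n p (Z : 'M[C]_(m, n)) (Z' : 'M[C]_(n, p)) :
  realification (Z *m Z') = realification Z *m realification Z'.
Proof.
have reM : map_mx re (Z *m Z') =
    map_mx re Z *m map_mx re Z' - map_mx im Z *m map_mx im Z'.
  apply/matrixP => i j; rewrite !mxE (big_morph _ ReD (erefl _)) -sumrB.
  by apply: eq_bigr => k _; rewrite !mxE; case: (Z i k) (Z' k j) => ? ? [].
have imM : map_mx im (Z *m Z') =
    map_mx re Z *m map_mx im Z' + map_mx im Z *m map_mx re Z'.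
  apply/matrixP => i j; rewrite !mxE (big_morph _ ImD (erefl _)) -big_split.
  by apply: eq_bigr => k _; rewrite !mxE; case: (Z i k) (Z' k j) => ? ? [].
rewrite /realification mulmx_block reM imM !mulNmx !mulmxN.
by congr block_mx; rewrite ?opprD // addrC.
Qed.

Lemma realification_tr m n (Z : 'M[C]_(m, n)) :
  realification (Z^t*) = (realification Z)^T.
Proof.
rewrite /realification tr_block_mx; congr block_mx; apply/matrixP => i j;
  by rewrite !mxE conjE //= opprK.
Qed.

Lemma realificationB m n (Z Z' : 'M[C]_(m, n)) :
  realification (Z - Z') = realification Z - realification Z'.
Proof.
rewrite /realification opp_block_mx add_block_mx.
congr block_mx; apply/matrixP => i j; rewrite !mxE;
  by case: (Z i j) (Z' i j) => ? ? [] //= *; rewrite opprD.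
Qed.

Lemma realification1 m : realification (1%:M : 'M[C]_m) = 1%:M.
Proof.
rewrite /realification scalar_mx_block; congr block_mx;
  apply/matrixP => i j; rewrite !mxE; case: (i == j); rewrite ?mulr1n ?mulr0n /=;
  by rewrite ?oppr0.
Qed.

Lemma realificationP m n (W X : 'M[R]_(m, n)) :
  exists Z : 'M[C]_(m, n), realification Z = block_mx W X (- X) W.
Proof.
exists (\matrix_(i, j) complex.Complex (W i j) (X i j)).
by congr block_mx; apply/matrixP => i j; rewrite !mxE.
Qed.

Lemma realification_sympJ m (Z : 'M[C]_m) :
  realification Z *m sympJ R m = sympJ R m *m realification Z.
Proof.
rewrite /sympJ /realification !mulmx_block.
by rewrite !(mulmx0, mul0mx, mulmx1, mul1mx, mulmxN, mulNmx, add0r, addr0).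
Qed.

Lemma l1norm_realification_ge m n (Z : 'M[C]_(m, n)) :
  l1norm Z <= toC (l1norm (realification Z)).
Proof.
apply: (@le_trans _ _ (toC (l1norm (map_mx re Z) + l1norm (map_mx im Z)))).
  rewrite -big_split (big_morph toC (fun x y => rmorphD _ x y) (rmorph0 _)).
  apply: ler_sum => i _; rewrite -big_split.
  rewrite (big_morph toC (fun x y => rmorphD _ x y) (rmorph0 _)).
  apply: ler_sum => j _; rewrite !mxE [X in `|X|]complexE rmorphD.
  apply: le_trans (ler_normD _ _) _; rewrite normrM.
  have nC (x : R) : `|toC x| = toC `|x|.
    by rewrite normc_def /= expr0n addr0 sqrtr_sqr.
  by rewrite complexiE normCi mul1r !nC.
rewrite lecR l1norm_block l1normN.
by have := l1norm_ge0 (map_mx re Z); have := l1norm_ge0 (map_mx im Z); lra.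
Qed.

Lemma l1norm_realification_le m n (Z : 'M[C]_(m, n)) :
  toC (l1norm (realification Z)) <= toC 4 * l1norm Z.
Proof.
have nre : toC (l1norm (map_mx re Z)) <= l1norm Z.
  rewrite (big_morph toC (fun x y => rmorphD _ x y) (rmorph0 _)).
  apply: ler_sum => i _.
  rewrite (big_morph toC (fun x y => rmorphD _ x y) (rmorph0 _)).
  by apply: ler_sum => j _; rewrite mxE normc_ge_Re.
have nim : toC (l1norm (map_mx im Z)) <= l1norm Z.
  rewrite (big_morph toC (fun x y => rmorphD _ x y) (rmorph0 _)).
  apply: ler_sum => i _.
  rewrite (big_morph toC (fun x y => rmorphD _ x y) (rmorph0 _)).
  apply: ler_sum => j _; rewrite mxE.
  (* the imaginary part of z is the real part of -iz *)
  have := normc_ge_Re (- 'i%C * Z i j).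
  rewrite normrM normrN complexiE normCi mul1r -complexiE.
  by case: (Z i j) => a b /=; rewrite (_ : - 0 * a - -1 * b = b) //; ring.
have -> : toC 4 = 4%:R by rewrite rmorph_nat.
rewrite l1norm_block l1normN !rmorphD /=.
have -> : 4%:R * l1norm Z = l1norm Z + l1norm Z + l1norm Z + l1norm Z by ring.
by do !apply: lerD.
Qed.

(** A matrix commuting with J is a complex matrix in disguise, so its unitary
    polar factor is the orthosymplectic matrix looked for. *)
Lemma near_orthosymplectic m (W X : 'M[R]_m) (M := block_mx W X (- X) W) :
  (m * m)%:R ^+ 2 * l1norm (M^T *m M - 1%:M) < 1 ->
  exists Q : 'M[R]_(m + m), orthosymplectic_mx Q /\
    l1norm (M - Q) <= 4 * (m * m)%:R ^+ 5 * l1norm (M^T *m M - 1%:M).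
Proof.
rewrite /M; have [U <-] := realificationP W X.
have -> : (realification U)^T *m realification U - 1%:M =
    realification (U^t* *m U - 1%:M).
  by rewrite realificationB realificationM realification1 realification_tr.
set P := U^t* *m U - 1%:M => small.
have le_toC : l1norm P <= toC (l1norm (realification P)).
  exact: l1norm_realification_ge.
have toCn k : (k%:R : C) = toC k%:R by rewrite rmorph_nat.
have small' : (m * m)%:R ^+ 2 * l1norm P < 1.
  apply: (@le_lt_trans _ _ ((m * m)%:R ^+ 2 * toC (l1norm (realification P)))).
    by apply: ler_wpM2l => //; rewrite exprn_ge0.
  by rewrite toCn -rmorphXn -rmorphM (_ : 1 = toC 1) ?ltcR.
have [Q [QQ nQ]] := near_unitary small'.
exists (realification Q); split; [split|].
- by rewrite -realification_tr -realificationM QQ realification1.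
- by rewrite /symplectic_mx -mulmxA -realification_sympJ mulmxA -realification_tr
    -realificationM QQ realification1 mul1mx.
rewrite -realificationB -lecR; apply: le_trans (l1norm_realification_le _) _.
rewrite -mulrA (rmorphM toC) ler_wpM2l ?ler0c //.
apply: le_trans nQ _; rewrite (rmorphM toC) (rmorphXn toC) toCn ler_wpM2l //.
by rewrite -(rmorphXn toC) ler0c exprn_ge0.
Qed.

End Realification.

(** * The spectral norm and the entrywise norm *)

Section SpectralNorm.
Variable R : realType.
Local Notation C := (complex R).
Local Notation toC := (real_complex R).

(** Every submultiplicative norm bounds the eigenvalues of M^T M: apply it to the
    eigenvector equation. *)
Lemma singular_value_le m (M : 'M[R]_m) s : singular_value M s -> s <= l1norm M.
Proof.
case=> s0 /eigenvalueP[v vE v0].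
have nv := l1norm_gt0 v0.
rewrite -(@ler_pXn2r _ 2) ?nnegrE ?l1norm_ge0 // -(ler_pM2l nv).
have -> : l1norm v * s ^+ 2 = l1norm (s ^+ 2 *: v).
  rewrite /l1norm mulr_suml; apply: eq_bigr => i _; rewrite mulr_suml.
  apply: eq_bigr => j _; rewrite mxE normrM.
  by rewrite [X in _ = X * _]ger0_norm ?exprn_ge0 // mulrC.
rewrite -vE mulmxA expr2 mulrA; apply: l1norm_mul_le => //.
by apply: l1norm_mul_le; rewrite ?l1norm_tr.
Qed.

Lemma spectral_norm_le m (M : 'M[R]_m) : spectral_norm M <= l1norm M.
Proof.
rewrite /spectral_norm.
have [->|/set0P ne] := eqVneq [set s | singular_value M s]%classic set0.
  by rewrite sup0 l1norm_ge0.
by apply: ge_sup => // s; exact: singular_value_le.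
Qed.

Lemma singular_value_le_spectral_norm m (M : 'M[R]_m) s :
  singular_value M s -> s <= spectral_norm M.
Proof.
move=> hs; apply: ub_le_sup => //; exists (l1norm M) => t.
exact: singular_value_le.
Qed.

(** The trace of M^T M is the sum of its [m] eigenvalues, so the largest of them
    is at least the average.  This is what bounds the spectral norm, a supremum,
    from below; the eigenvalues come from diagonalizing over the complex
    numbers, where they turn out to be real. *)
Lemma large_singular_value m (M : 'M[R]_m) : (0 < m)%N ->
  exists2 s, singular_value M s & \tr (M^T *m M) <= m%:R * s ^+ 2.
Proof.
move=> m0.
have gramE j : (M^T *m M) j j = \sum_i (M i j) ^+ 2.
  by rewrite mxE; apply: eq_bigr => i _; rewrite mxE expr2.
set G := M^T *m M in gramE *.
have GT : G^T = G by rewrite /G trmx_mul trmxK.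
pose GC := map_mx toC G.
have hGC : map_mx Num.conj GC^T = GC.
  rewrite /GC map_trmx GT -map_mx_comp; apply/matrixP => i j; rewrite !mxE /=.
  by apply/CrealP; rewrite complex_real.
have [V [l [uV VV lreal GE]]] := hermitian_diagonalization hGC.
have /unitarymxP VV' := uV.
pose r k := complex.Re (l 0 k).
have lE k : l 0 k = toC (r k) by rewrite /r RRe_real.
have trE : \tr G = \sum_k r k.
  apply: (@complexI R); rewrite -trace_map_mx -/GC GE mxtrace_mulC mulmxA VV' mul1mx.
  rewrite mxtrace_diag (big_morph toC (fun x y => rmorphD _ x y) (rmorph0 _)).
  by apply: eq_bigr => k _; rewrite lE.
have eig k : eigenvalue G (r k).
  suff : eigenvalue GC (l 0 k) by rewrite lE eigenvalue_map.
  apply/eigenvalueP.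
  exists (row k V).
    rewrite -row_mul GE !mulmxA VV' mul1mx row_mul row_diag_mx.
    by rewrite -scalemxAl -rowE.
  apply/negP => /eqP V0; have /matrixP/(_ k k) := VV'.
  rewrite !mxE eqxx mulr1n big1 => [/eqP|j _]; first by rewrite eq_sym oner_eq0.
  by move/rowP: V0 => /(_ j); rewrite !mxE => ->; rewrite mul0r.
have [k _ kmax] := @arg_maxP _ _ _ (Ordinal m0) xpredT r isT.
have tr_le : \tr G <= m%:R * r k.
  rewrite trE mulr_natl -[m in _ *+ m]card_ord -sumr_const.
  by apply: ler_sum => j _; exact: kmax.
have tr_ge0 : 0 <= \tr G.
  by apply: sumr_ge0 => j _; rewrite gramE sumr_ge0 // => i _; rewrite sqr_ge0.
have rk0 : 0 <= r k.
  by rewrite -(pmulr_rge0 _ (_ : 0 < m%:R)) ?ltr0n // (le_trans tr_ge0).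
by exists (Num.sqrt (r k)); [split; rewrite ?sqrtr_ge0 //|]; rewrite sqr_sqrtr.
Qed.

Lemma spectral_norm_ge0 m (M : 'M[R]_m) : 0 <= spectral_norm M.
Proof.
have [E|/set0P[s hs]] := eqVneq [set s | singular_value M s]%classic set0.
  by rewrite /spectral_norm E sup0.
by apply: le_trans (singular_value_le_spectral_norm hs); case: hs.
Qed.

Lemma l1norm_le_spectral_norm m (M : 'M[R]_m) :
  l1norm M <= (m * m)%:R * (m%:R * spectral_norm M).
Proof.
case: m M => [|m] M; first by rewrite /l1norm big_ord0 mul0r.
have [s hs trs] := large_singular_value M (ltn0Sn m).
have ss := singular_value_le_spectral_norm hs.
have s0 : 0 <= s by case: hs.
apply: l1norm_le => i j; apply: (@le_trans _ _ (m.+1%:R * s)); last first.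
  by rewrite ler_wpM2l.
rewrite -(@ler_pXn2r _ 2) ?nnegrE ?mulr_ge0 // real_normK ?num_real // exprMn.
apply: (@le_trans _ _ (m.+1%:R * s ^+ 2)); last first.
  rewrite ler_wpM2r ?sqr_ge0 // -natrX ler_nat -{1}(expn1 m.+1) leq_pexp2l //.
apply: le_trans trs; rewrite /mxtrace (bigD1 j) //= mxE (bigD1 i) //= mxE -expr2.
rewrite -addrA lerDl addr_ge0 // sumr_ge0 // => k _.
  by rewrite mxE -expr2 sqr_ge0.
by rewrite mxE sumr_ge0 // => l _; rewrite mxE -expr2 sqr_ge0.
Qed.

End SpectralNorm.

(** * Determinants and symplectic matrices *)

Section Symplectic.
Variable R : realType.

(** Pigeonhole: the image of [I] is too large to miss [K]. *)
Lemma perm_meets_rectangle m (I K : {set 'I_m}) (s : 'S_m) :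
  (m < #|I| + #|K|)%N -> exists2 i, i \in I & s i \in K.
Proof.
move=> big; have [H|[k]] := set_0Vmem ((s @: I) :&: K)%SET; last first.
  by rewrite inE => /andP[/imsetP[i iI ->] siK]; exists i.
move: big; rewrite ltnNge -(card_imset I (@perm_inj _ s)) -cardsUI H cards0 addn0.
by rewrite -[m in (_ <= m)%N]card_ord max_card.
Qed.

(** The quantitative form of the fact that a matrix with a zero [I] x [K]
    rectangle is singular when #|I| + #|K| > m: every term of the Leibniz
    formula has a factor in that rectangle. *)
Lemma det_small_rectangle m (M : 'M[R]_m) (I K : {set 'I_m}) (b eta : R) :
  (m < #|I| + #|K|)%N -> 1 <= b -> (forall i j, `|M i j| <= b) ->
  {in I & K, forall i k, `|M i k| <= eta} ->
  `|\det M| <= (m`!)%:R * (eta * b ^+ m).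
Proof.
move=> big b1 Mb Meta; rewrite -card_Sn -mulr_natl mulr1 -sum1_card natr_sum mulr_suml.
rewrite /determinant; apply: le_trans (ler_norm_sum _ _ _) _.
rewrite [leRHS](eq_bigl xpredT) => [|s]; last by rewrite inE.
apply: ler_sum => s _; rewrite mul1r normrM normr_prod normrX normrN1 expr1n mul1r.
have [i iI siK] := perm_meets_rectangle s big.
rewrite (bigD1 i) //=; apply: ler_pM => //; first exact: prodr_ge0.
  exact: Meta.
apply: (@le_trans _ _ (\prod_(j < m | j != i) b)).
  by apply: ler_prod => j _; rewrite normr_ge0 Mb.
by rewrite prodr_const ler_weXn2l // -[leqRHS]card_ord max_card.
Qed.

Lemma sympJ_sqr n : sympJ R n *m sympJ R n = - 1%:M.
Proof.
rewrite /sympJ mulmx_block.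
rewrite !(mulmx0, mul0mx, mulmx1, mul1mx, mulmxN, mulNmx, add0r, addr0).
by rewrite (scalar_mx_block n n) opp_block_mx !oppr0.
Qed.

Lemma symplectic_mulVmx n (M : 'M[R]_(n + n)) : symplectic_mx M ->
  (- (sympJ R n *m M^T *m sympJ R n)) *m M = 1%:M.
Proof. by move=> hM; rewrite mulNmx -!mulmxA [M^T *m _]mulmxA hM sympJ_sqr opprK. Qed.

Lemma symplectic_tr n (M : 'M[R]_(n + n)) : symplectic_mx M ->
  M *m sympJ R n *m M^T = sympJ R n.
Proof.
move=> /symplectic_mulVmx /mulmx1C => /(congr1 (mulmx^~ (sympJ R n))).
by rewrite mul1mx mulmxN mulNmx -!mulmxA sympJ_sqr !mulmxN opprK mulmx1 !mulmxA.
Qed.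

Lemma symplectic_unitmx n (M : 'M[R]_(n + n)) : symplectic_mx M -> M \in unitmx.
Proof. by move=> /symplectic_mulVmx /mulmx1_unit[]. Qed.

Lemma symplectic_det n (M : 'M[R]_(n + n)) : symplectic_mx M -> `|\det M| = 1.
Proof.
move=> hM; have /(congr1 determinant) := hM; rewrite !det_mulmx det_tr.
have J0 : \det (sympJ R n) != 0.
  have /(congr1 determinant) := sympJ_sqr n; rewrite det_mulmx -scaleN1r detZ det1.
  by move=> J2; apply: contra_eq_neq J2 => ->; rewrite mul0r mulr1 eq_sym signr_eq0.
move=> H; apply/eqP; rewrite -(@eqrXn2 _ 2) // expr1n real_normK ?num_real //.
by apply/eqP/(mulIf J0); rewrite mul1r -[RHS]H expr2 mulrAC.
Qed.

Lemma col_unitmx_neq0 m (M : 'M[R]_m) j : M \in unitmx -> col j M != 0.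
Proof.
move=> uM; apply/negP => /eqP c0; have := mulVmx uM.
move/(congr1 (col j)); rewrite colE -mulmxA -colE c0 mulmx0.
by move/colP/(_ j); rewrite !mxE eqxx => /eqP; rewrite eq_sym oner_eq0.
Qed.

Lemma symplecticM n (M M' : 'M[R]_(n + n)) :
  symplectic_mx M -> symplectic_mx M' -> symplectic_mx (M *m M').
Proof.
move=> hM hM'; rewrite /symplectic_mx trmx_mul.
by rewrite -!mulmxA [M^T *m _]mulmxA [_ *m (M *m _)]mulmxA hM mulmxA.
Qed.

Lemma symplecticV n (M : 'M[R]_(n + n)) :
  symplectic_mx M -> symplectic_mx (invmx M).
Proof.
move=> hM; have uM := symplectic_unitmx hM.
rewrite /symplectic_mx -{1}hM !mulmxA -trmx_mul mulmxV // trmx1 mul1mx.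
by rewrite -mulmxA mulmxV // mulmx1.
Qed.

Definition doubled_set n (S : {set 'I_n}) : {set 'I_(n + n)} :=
  (@lshift n n @: S) :|: (@rshift n n @: S).

Lemma card_doubled_set n (S : {set 'I_n}) : #|doubled_set S| = (#|S| + #|S|)%N.
Proof.
rewrite cardsU (card_imset _ (@lshift_inj _ _)) (card_imset _ (@rshift_inj _ _)).
rewrite (_ : _ :&: _ = finset.set0) ?cards0 ?subn0 //.
apply/setP => i; rewrite !inE; apply/negP => /andP[/imsetP[a _ ->] /imsetP[b _]].
by move/eqP; rewrite eq_lrshift.
Qed.

(** Since |det M| = 1, no symplectic matrix of bounded size can be small on a
    rectangle that is too large, the rectangle being repeated in each of the
    four blocks. *)
Lemma symplectic_no_small_rectangle n (M : 'M[R]_(n + n)) (S T : {set 'I_n}) b eta :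
  symplectic_mx M -> (n < #|S| + #|T|)%N ->
  1 <= b -> (forall i j, `|M i j| <= b) ->
  {in S & T, forall i j, [/\ `|ulsubmx M i j| <= eta, `|ursubmx M i j| <= eta,
     `|dlsubmx M i j| <= eta & `|drsubmx M i j| <= eta]} ->
  1 <= ((n + n)`!)%:R * (eta * b ^+ (n + n)).
Proof.
move=> hM big b1 Mb small; rewrite -[leLHS](symplectic_det hM).
apply: (@det_small_rectangle _ M (doubled_set S) (doubled_set T)) => //.
  by rewrite !card_doubled_set addnACA !addnn ltn_double.
move=> i j; rewrite !inE => iS jT.
by case/orP: iS => /imsetP[i' iS ->]; case/orP: jT => /imsetP[j' jT ->];
  have [] := small i' j' iS jT; rewrite !mxE.
Qed.

End Symplectic.

(** * Symplectic diagonalization of a perturbed diagonal matrix *)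

Section Perturbation.
Variable R : realType.

Lemma common_lower_bound (I : finType) (P : pred I) (f : I -> R) :
  (forall i, P i -> 0 < f i) -> exists2 g, 0 < g & forall i, P i -> g <= f i.
Proof.
move=> f0; have s0 : 0 <= \sum_(i | P i) (f i)^-1.
  by apply: sumr_ge0 => i /f0 /ltW; rewrite invr_ge0.
exists (1 + \sum_(i | P i) (f i)^-1)^-1; first by rewrite invr_gt0 ltr_wpDr.
move=> i Pi; rewrite -[leRHS]invrK lef_pV2 ?posrE ?invr_gt0 ?f0 ?ltr_wpDr //.
rewrite (bigD1 i) //= addrCA lerDl addr_ge0 // sumr_ge0 // => j /andP[/f0 /ltW].
by rewrite invr_ge0.
Qed.

(** The scalar system behind the entrywise estimates: its sum and difference read
    (d - e)(w + z) = O(f) and (d + e)(w - z) = O(f), and d + e is bounded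
    below by [d]. *)
Lemma sylvester_2x2 (d e w z f : R) : 0 < d -> 0 < e ->
  `|d * z - w * e| <= f -> `|d * w - z * e| <= f ->
  [/\ `|d - e| * `|w| <= f, `|d - e| * `|z| <= f & d * `|w - z| <= 2 * f].
Proof.
move=> d0 e0 h1 h2; have de : 0 < d + e by rewrite addr_gt0.
have key a b : `|d * b - a * e| <= f -> `|d * a - b * e| <= f ->
    `|d - e| * `|a| <= f.
  move=> k1 k2; rewrite -normrM -(ler_pM2r de) -{1}(gtr0_norm de) -normrM.
  have -> : (d - e) * a * (d + e) = d * (d * a - b * e) + e * (d * b - a * e) by ring.
  apply: le_trans (ler_normD _ _) _; rewrite !normrM (gtr0_norm d0) (gtr0_norm e0).
  by rewrite mulrDr [f * d]mulrC [f * e]mulrC lerD // ler_pM2l.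
split; [exact: key h1 h2|exact: key h2 h1|].
rewrite -[d in d * _](gtr0_norm d0) -normrM.
apply: (@le_trans _ _ ((d + e) * `|w - z|)).
  by rewrite normrM (gtr0_norm d0) ler_wpM2r // lerDl ltW.
rewrite -{1}(gtr0_norm de) -normrM.
have -> : (d + e) * (w - z) = (d * w - z * e) - (d * z - w * e) by ring.
apply: le_trans (ler_normB _ _) _.
by rewrite mulr_natl mulr2n lerD.
Qed.

Variable n : nat.
Implicit Types (d e : 'rV[R]_n) (E M : 'M[R]_(n + n)).

Definition doubled_diag d : 'M[R]_(n + n) := dsum_mx (diag_mx d) (diag_mx d).

Definition diagonalizes_perturbation d E e M :=
  [/\ symplectic_mx M, M^T *m (doubled_diag d + E) *m M = doubled_diag e &
      forall j, 0 < e 0 j].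

(** M^T K M = L turns into (J K) M = M (J L) because M^(-T) = J M J^(-1): the
    congruence becomes a similarity, hence a linear equation in M. *)
Lemma intertwine d E e M : diagonalizes_perturbation d E e M ->
  sympJ R n *m (doubled_diag d + E) *m M = M *m (sympJ R n *m doubled_diag e).
Proof. by case=> hM <- _; rewrite !mulmxA symplectic_tr. Qed.

Lemma sympJ_doubled_diag e :
  sympJ R n *m doubled_diag e = block_mx 0 (diag_mx e) (- diag_mx e) 0.
Proof.
rewrite /sympJ /doubled_diag /dsum_mx mulmx_block.
by rewrite !(mulmx0, mul0mx, mulmx1, mul1mx, mulmxN, mulNmx, add0r, addr0).
Qed.

(** The square of J (D (+) D) is - (D^2 (+) D^2), so that the columns of a matrix
    [M] as in [intertwine] are eigenvectors of (J K)^2. *)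
Lemma doubled_diag_entry e (p : 'I_(n + n)) :
  exists j, doubled_diag e p p = e 0 j /\
    forall m (M : 'M_(m, n + n)) i,
      (M *m (sympJ R n *m doubled_diag e) *m (sympJ R n *m doubled_diag e)) i p =
      - M i p * e 0 j ^+ 2.
Proof.
have sqE : (sympJ R n *m doubled_diag e) *m (sympJ R n *m doubled_diag e) =
    - diag_mx (row_mx (\row_j e 0 j ^+ 2) (\row_j e 0 j ^+ 2)).
  rewrite sympJ_doubled_diag mulmx_block diag_mx_row opp_block_mx.
  rewrite !(mulmx0, mul0mx, mulmxN, mulNmx, add0r, addr0) mulmx_diag oppr0.
  by congr block_mx; congr (- diag_mx _); apply/rowP => j; rewrite !mxE expr2.
case: (split_ordP p) => j ->; exists j; rewrite /doubled_diag /dsum_mx.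
  split=> [|m M i]; first by rewrite block_mxEul mxE eqxx.
  by rewrite -mulmxA -/(doubled_diag e) sqE mulmxN mxE mul_mx_diag mxE row_mxEl mxE mulNr.
split=> [|m M i]; first by rewrite block_mxEdr mxE eqxx.
by rewrite -mulmxA -/(doubled_diag e) sqE mulmxN mxE mul_mx_diag mxE row_mxEr mxE mulNr.
Qed.

(** The perturbed symplectic eigenvalues are bounded since - e_j^2 is an
    eigenvalue of (J K)^2, K being the perturbed matrix. *)
Lemma perturbed_eig_le d E e M p : diagonalizes_perturbation d E e M ->
  doubled_diag e p p <= l1norm (sympJ R n) * (l1norm (doubled_diag d) + l1norm E).
Proof.
move=> hM; have [j [-> sqE]] := doubled_diag_entry e p.
have e0 : 0 < e 0 j by case: hM.
set B := sympJ R n *m (doubled_diag d + E).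
have nB : l1norm B <= l1norm (sympJ R n) * (l1norm (doubled_diag d) + l1norm E).
  by apply: l1norm_mul_le => //; exact: l1normD.
apply: le_trans nB.
have x0 : 0 < l1norm (col p M).
  by apply/l1norm_gt0/col_unitmx_neq0/symplectic_unitmx; case: hM.
rewrite -(@ler_pXn2r _ 2) ?nnegrE ?l1norm_ge0 ?(ltW e0) // -(ler_pM2r x0).
have <- : l1norm (B *m (B *m col p M)) = e 0 j ^+ 2 * l1norm (col p M).
  have -> : B *m (B *m col p M) = - (e 0 j ^+ 2) *: col p M.
    have -> : B *m (B *m col p M) = col p (B *m (B *m M)) by rewrite !colE !mulmxA.
    rewrite (intertwine hM) mulmxA (intertwine hM).
    by apply/colP => i; rewrite mxE sqE !mxE !mulNr mulrC.
  rewrite /l1norm mulr_sumr; apply: eq_bigr => i _; rewrite mulr_sumr.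
  by apply: eq_bigr => k _; rewrite mxE normrM normrN [X in X * _ = _]ger0_norm ?sqr_ge0.
rewrite expr2 -mulrA; apply: l1norm_mul_le => //.
exact: l1normM.
Qed.

(** If x is the p-th column of M then x^T (D (+) D + E) x is a perturbed
    eigenvalue, while the quadratic form is bounded below by g - |E|. *)
Lemma perturbed_column_le d E e M p g K :
  (forall j, g <= d 0 j) -> diagonalizes_perturbation d E e M ->
  doubled_diag e p p <= K -> (g - l1norm E) * \sum_i M i p ^+ 2 <= K.
Proof.
move=> gd [_ hM _]; rewrite -hM; set S := \sum_i _.
have S0 : 0 <= S by apply: sumr_ge0 => i _; rewrite sqr_ge0.
have MS i : `|M i p| ^+ 2 <= S.
  rewrite real_normK ?num_real // /S (bigD1 i) //= lerDl sumr_ge0 // => k _.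
  exact: sqr_ge0.
have MMS i k : `|M i p * M k p| <= S.
  rewrite normrM.
  have := MS i; have := MS k; have := sqr_ge0 (`|M i p| - `|M k p|); nra.
have E1 : `|(M^T *m E *m M) p p| <= l1norm E * S.
  rewrite !mxE; apply: le_trans (ler_norm_sum _ _ _) _.
  rewrite -l1norm_tr mulr_suml; apply: ler_sum => i _; rewrite !mxE.
  rewrite normrM mulr_suml.
  apply: le_trans (ler_wpM2r (normr_ge0 _) (ler_norm_sum _ _ _)) _.
  rewrite mulr_suml; apply: ler_sum => k _; rewrite !mxE -normrM.
  by rewrite mulrAC normrM mulrC ler_wpM2l.
have E2 : g * S <= (M^T *m doubled_diag d *m M) p p.
  have -> : doubled_diag d = diag_mx (row_mx d d) by rewrite diag_mx_row.
  rewrite mul_mx_diag mxE.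
  rewrite /S mulr_sumr; apply: ler_sum => i _.
  rewrite !mxE [leRHS]mulrAC -expr2 [leRHS]mulrC.
  by apply: ler_wpM2r; rewrite ?sqr_ge0 //; case: splitP => j _; exact: gd.
rewrite mulmxDr mulmxDl [X in X <= _]mxE.
by have := ler_norm (- (M^T *m E *m M) p p); rewrite normrN; nra.
Qed.

(** The eigenvalue bound controls the quadratic form on the columns of M, and the
    smallest entry of [d] bounds that form from below once E is half as small. *)
Lemma perturbed_bounded d : (forall j, 0 < d 0 j) ->
  exists K delta, [/\ 1 <= K, 0 < delta & forall E e M, l1norm E < delta ->
    diagonalizes_perturbation d E e M -> l1norm M <= K].
Proof.
move=> d0; have [g g0 gd] := common_lower_bound (P := xpredT) (fun j _ => d0 j).
have gd' j : g <= d 0 j := gd j isT.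
pose b := l1norm (sympJ R n) * (l1norm (doubled_diag d) + g).
have b0 : 0 <= b by rewrite mulr_ge0 ?addr_ge0 ?l1norm_ge0 // ltW.
pose K := ((n + n) * (n + n))%:R * (1 + 2 * b / g).
have bg0 : 0 <= b / g by rewrite divr_ge0 // ltW.
exists (1 + K), (g / 2); split=> [||E e M smallE hM]; rewrite ?divr_gt0 //.
  by rewrite lerDl mulr_ge0 //; lra.
have K1 : l1norm M <= K.
  apply: l1norm_le => i p.
  have epb : doubled_diag e p p <= b.
    apply: le_trans (perturbed_eig_le p hM) _; apply: ler_wpM2l.
      exact: l1norm_ge0.
    by rewrite lerD2l; lra.
  have := perturbed_column_le gd' hM epb; set S := \sum_i _ => Sb.
  have MS : M i p ^+ 2 <= S.
    by rewrite /S (bigD1 i) //= lerDl sumr_ge0 // => k _; exact: sqr_ge0.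
  have S0 : 0 <= S by apply: le_trans MS; exact: sqr_ge0.
  have Sbg : S <= 2 * b / g by rewrite ler_pdivlMr //; nra.
  have : `|M i p| ^+ 2 <= S by rewrite real_normK ?num_real.
  (* t <= 1 + t^2 avoids a square root *)
  by have := sqr_ge0 (`|M i p| - 1); nra.
by apply: le_trans K1 _; rewrite lerDr.
Qed.

(** The four blocks W, X, Y, Z of [M] satisfy entrywise the equation
    J (D (+) D) M - M J (D' (+) D') = - J E M, which couples W with Z and X
    with Y as in [sylvester_2x2].  Hence [M] almost commutes with J, and its
    (i, j) entries are small unless e_j is close to d_i. *)
Lemma perturbed_entries d : (forall j, 0 < d 0 j) ->
  exists c delta, [/\ 0 < c, 0 < delta & forall E e M, l1norm E < delta ->
    diagonalizes_perturbation d E e M ->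
    [/\ l1norm M <= c,
    forall i j, [/\ `|d 0 i - e 0 j| * `|ulsubmx M i j| <= c * l1norm E,
                   `|d 0 i - e 0 j| * `|ursubmx M i j| <= c * l1norm E,
                   `|d 0 i - e 0 j| * `|dlsubmx M i j| <= c * l1norm E &
                   `|d 0 i - e 0 j| * `|drsubmx M i j| <= c * l1norm E] &
    forall i j, `|ulsubmx M i j - drsubmx M i j| <= c * l1norm E /\
                `|ursubmx M i j + dlsubmx M i j| <= c * l1norm E]].
Proof.
move=> d0; have [g g0 gd] := common_lower_bound (P := xpredT) (fun j _ => d0 j).
have [K [delta [K1 delta0 HK]]] := perturbed_bounded d0.
pose k := l1norm (sympJ R n) * K.
have k0 : 0 <= k by rewrite mulr_ge0 ?l1norm_ge0 //; lra.
have kg0 : 0 <= 2 * k / g by apply: divr_ge0; [rewrite mulr_ge0|exact: ltW].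
have c0 : 0 < K + k + 2 * k / g by lra.
exists (K + k + 2 * k / g), delta; split=> // E e M smallE hM.
have MK := HK _ _ _ smallE hM.
have E0 := l1norm_ge0 E.
have e0 j : 0 < e 0 j by case: hM.
have FE := intertwine hM; rewrite mulmxDr mulmxDl in FE.
move: FE; set F := sympJ R n *m E *m M => FE.
have nF : l1norm F <= k * l1norm E.
  by rewrite /k mulrAC; apply: l1norm_mul_le => //; exact: l1normM.
have nFE i j : `|F i j| <= k * l1norm E.
  by apply: le_trans nF; exact: le_entry_l1norm.
rewrite !sympJ_doubled_diag -[M]submxK !mulmx_block -[F]submxK in FE.
rewrite !(mulmx0, mul0mx, mulmxN, mulNmx, add0r, addr0) add_block_mx in FE.
move: FE => /eq_block_mx[/matrixP F1 /matrixP F2 /matrixP F3 /matrixP F4].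
pose W := ulsubmx M; pose X := ursubmx M.
pose Y := dlsubmx M; pose Z := drsubmx M.
rewrite -/W -/X -/Y -/Z in F1 F2 F3 F4.
have key i j : [/\ `|d 0 i * Z i j - W i j * e 0 j| <= k * l1norm E,
    `|d 0 i * W i j - Z i j * e 0 j| <= k * l1norm E,
    `|d 0 i * - Y i j - X i j * e 0 j| <= k * l1norm E &
    `|d 0 i * X i j - (- Y i j) * e 0 j| <= k * l1norm E].
  move: (F1 i j) (F2 i j) (F3 i j) (F4 i j).
  rewrite !mul_diag_mx !mul_mx_diag ![(_ + _ : 'M__) _ _]mxE.
  rewrite ![(- _ : 'M__) _ _]mxE ![(\matrix_(_, _) _) _ _]mxE.
  move=> {}F1 {}F2 {}F3 {}F4; split.
  - have -> : d 0 i * Z i j - W i j * e 0 j = - ursubmx F i j by lra.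
    by rewrite normrN mxE mxE.
  - have -> : d 0 i * W i j - Z i j * e 0 j = dlsubmx F i j by lra.
    by rewrite mxE mxE.
  - have -> : d 0 i * - Y i j - X i j * e 0 j = ulsubmx F i j by lra.
    by rewrite mxE mxE.
  - have -> : d 0 i * X i j - - Y i j * e 0 j = drsubmx F i j by lra.
    by rewrite mxE mxE.
have kE0 : 0 <= k * l1norm E by rewrite mulr_ge0.
have kgE0 : 0 <= 2 * k / g * l1norm E by rewrite mulr_ge0.
have KE0 : 0 <= K * l1norm E by rewrite mulr_ge0 //; lra.
have kc : k * l1norm E <= (K + k + 2 * k / g) * l1norm E by rewrite !mulrDl; lra.
have dc i x : d 0 i * `|x| <= 2 * (k * l1norm E) ->
    `|x| <= (K + k + 2 * k / g) * l1norm E.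
  move=> dx; apply: (@le_trans _ _ (2 * k / g * l1norm E)).
    rewrite mulrAC ler_pdivlMr // -mulrA; apply: le_trans dx.
    by rewrite mulrC; apply: ler_wpM2r => //; exact: gd.
  by rewrite !mulrDl; lra.
split=> [|i j|i j]; first by lra.
  have [h1 h2 h3 h4] := key i j.
  have [s1 s2 _] := sylvester_2x2 (d0 i) (e0 j) h1 h2.
  have [s3 s4 _] := sylvester_2x2 (d0 i) (e0 j) h3 h4.
  by rewrite normrN in s4; split; apply: le_trans kc.
have [h1 h2 h3 h4] := key i j.
have [_ _ s1] := sylvester_2x2 (d0 i) (e0 j) h1 h2.
have [_ _ s2] := sylvester_2x2 (d0 i) (e0 j) h3 h4.
by rewrite opprK in s2; split; apply: dc; eassumption.
Qed.

Lemma card_ord_le (j : 'I_n) :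
  (n < #|[set i : 'I_n | (i <= j)%N]%SET| + #|[set i : 'I_n | (j <= i)%N]%SET|)%N.
Proof.
rewrite -cardsUI -[X in (X < _)%N]card_ord -cardsT -[X in (X < _)%N]addn0.
have -> : ([set i : 'I_n | (i <= j)%N] :|: [set i : 'I_n | (j <= i)%N] =
    [set: 'I_n])%SET.
  by apply/setP => i; rewrite !inE leq_total.
by rewrite ltn_add2l card_gt0; apply/set0Pn; exists j; rewrite !inE leqnn.
Qed.

(** If e_j is far above d_j, then by monotonicity e_k is far from d_i whenever
    i <= j <= k, so by [perturbed_entries]
    [M] is small on a rectangle with j + (n - j + 1) > n rows and columns, which
    [symplectic_no_small_rectangle] excludes; likewise if e_j is far below. *)
Lemma perturbed_eig_close d g : (forall j, 0 < d 0 j) ->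
  (forall j k : 'I_n, (j <= k)%N -> d 0 j <= d 0 k) -> 0 < g ->
  exists2 delta, 0 < delta & forall E e M, l1norm E < delta ->
    (forall j k : 'I_n, (j <= k)%N -> e 0 j <= e 0 k) ->
    diagonalizes_perturbation d E e M -> forall j, `|d 0 j - e 0 j| < g.
Proof.
move=> d0 dmono g0; have [c [delta [c0 delta0 Hc]]] := perturbed_entries d0.
pose D := ((n + n)`!)%:R * (1 + c) ^+ (n + n) : R.
have D0 : 0 < D by rewrite mulr_gt0 ?ltr0n ?fact_gt0 // exprn_gt0 // addr_gt0.
exists (Num.min delta (g / (D * c))).
  by rewrite lt_min delta0 divr_gt0 // (mulr_gt0 D0 c0).
move=> E e M; rewrite lt_min => /andP[smallE Eg] emono hM j.
have [Mc ent _] := Hc _ _ _ smallE hM.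
have hS : symplectic_mx M by case: hM.
pose eta := c * l1norm E / g.
have no_rect (S T : {set 'I_n}) : (n < #|S| + #|T|)%N ->
    {in S & T, forall i k, g <= `|d 0 i - e 0 k|} -> False.
  move=> big gST; suff : 1 <= ((n + n)`!)%:R * (eta * (1 + c) ^+ (n + n)).
    rewrite mulrCA -/D /eta mulrAC ler_pdivlMr // mul1r.
    move=> big_g; move: Eg; rewrite ltr_pdivlMr ?(mulr_gt0 D0 c0) // ltNge.
    by rewrite mulrA mulrAC [_ * c]mulrC big_g.
  apply: (@symplectic_no_small_rectangle _ _ M S T) => //.
  - by rewrite lerDl ltW.
  - by move=> i k; apply: le_trans (le_entry_l1norm _ _ _) _; lra.
  move=> i k iS kT; have gik := gST i k iS kT.
  have small x : `|d 0 i - e 0 k| * `|x| <= c * l1norm E -> `|x| <= eta.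
    move=> hx; rewrite /eta ler_pdivlMr // mulrC; apply: le_trans hx.
    exact: ler_wpM2r.
  by have [? ? ? ?] := ent i k; split; exact: small.
rewrite ltNge; apply/negP => far.
have [lt_de|le_ed] := ltP (d 0 j) (e 0 j).
  apply: (no_rect _ _ (card_ord_le j)) => i k; rewrite !inE => ij jk.
  have dij := dmono _ _ ij; have ejk := emono _ _ jk.
  by move: far; rewrite !ler0_norm; lra.
have := card_ord_le j; rewrite addnC => /no_rect; apply=> i k; rewrite !inE => ji kj.
have dji := dmono _ _ ji; have ekj := emono _ _ kj.
by move: far; rewrite !ger0_norm; lra.
Qed.

End Perturbation.

(** * Truncation to the commutant of J and to the eigenvalue classes *)

Section Truncation.
Variable R : realType.
Variable n : nat.
Implicit Types (d e : 'rV[R]_n) (E M : 'M[R]_(n + n)).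

Definition class_truncation d (W : 'M[R]_n) : 'M[R]_n :=
  \matrix_(i, j) if d 0 i == d 0 j then W i j else 0.

(** When [M] nearly commutes with J its lower blocks repeat the upper ones up to a
    small error; dropping them makes the commutation exact. *)
Definition complex_truncation d M : 'M[R]_(n + n) :=
  let W := class_truncation d (ulsubmx M) in
  let X := class_truncation d (ursubmx M) in block_mx W X (- X) W.

Lemma complex_truncation_sympJ d M :
  complex_truncation d M *m sympJ R n = sympJ R n *m complex_truncation d M.
Proof.
rewrite /complex_truncation; set W := class_truncation d _.
set X := class_truncation d _.
rewrite /sympJ !mulmx_block.
by rewrite !(mulmx0, mul0mx, mulmx1, mul1mx, mulmxN, mulNmx, add0r, addr0).
Qed.

(** For a matrix commuting with J, being symplectic and being orthogonal are the
    same equation: G^T G - 1 = (G^T J G - J) J^(-1).  So a matrix commuting with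
    J and close to a symplectic one is almost orthogonal. *)
Lemma commuting_gram_le (M G : 'M[R]_(n + n)) (J := sympJ R n) :
  symplectic_mx M -> G *m J = J *m G ->
  l1norm (G^T *m G - 1%:M) <=
    l1norm (M - G) * l1norm J ^+ 2 * (2 * l1norm M + l1norm (M - G)).
Proof.
move=> hM GJ.
have JJ : J *m - J = 1%:M by rewrite mulmxN sympJ_sqr opprK.
have -> : G^T *m G - 1%:M = (G^T *m J *m G - M^T *m J *m M) *m - J.
  by rewrite hM mulmxBl -/J JJ -[G^T *m J *m G]mulmxA -GJ -!mulmxA JJ mulmx1.
have -> : G^T *m J *m G - M^T *m J *m M =
    - ((M - G)^T *m J *m M + G^T *m J *m (M - G)).
  rewrite [(M - G)^T]linearB /= !mulmxBl mulmxBr.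
  by rewrite addrA subrK opprB.
have nG : l1norm G <= l1norm M + l1norm (M - G).
  by rewrite -{1}[G](subKr M); exact: l1normB.
have N0 := l1norm_ge0 (M - G); have M0 := l1norm_ge0 M; have J0 := l1norm_ge0 J.
apply: (@le_trans _ _ ((l1norm (M - G) * l1norm J * l1norm M +
    (l1norm M + l1norm (M - G)) * l1norm J * l1norm (M - G)) * l1norm J)).
  apply: l1norm_mul_le; rewrite l1normN //.
  apply: le_trans (l1normD _ _) (lerD _ _).
    by do !apply: l1norm_mul_le => //; rewrite l1norm_tr.
  by do !apply: l1norm_mul_le => //; rewrite l1norm_tr.
by rewrite le_eqVlt; apply/orP; left; apply/eqP; ring.
Qed.

(** The entries removed by the truncation join d_i <> d_j.  Once each e_j is within
    half a gap of d_j, such an e_j is away from d_i and [perturbed_entries]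
    bounds the entry. *)
Lemma perturbed_truncation d : (forall j, 0 < d 0 j) ->
  (forall j k : 'I_n, (j <= k)%N -> d 0 j <= d 0 k) ->
  exists c delta, [/\ 0 < c, 0 < delta & forall E e M, l1norm E < delta ->
    (forall j k : 'I_n, (j <= k)%N -> e 0 j <= e 0 k) ->
    diagonalizes_perturbation d E e M ->
    l1norm (M - complex_truncation d M) <= c * l1norm E /\
    l1norm ((complex_truncation d M)^T *m complex_truncation d M - 1%:M)
      <= c * l1norm E].
Proof.
move=> d0 dmono; have [c [delta [c0 delta0 Hc]]] := perturbed_entries d0.
have gap_pos (p : 'I_n * 'I_n) : d 0 p.1 != d 0 p.2 -> 0 < `|d 0 p.1 - d 0 p.2|.
  by rewrite normr_gt0 subr_eq0.
have [g g0 gap] := common_lower_bound gap_pos.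
have [delta' delta'0 close] := perturbed_eig_close d0 dmono (divr_gt0 g0 (ltr0n _ 2)).
pose c1 := c + c / (g / 2).
have cg0 : 0 < c / (g / 2) by rewrite !divr_gt0.
pose c2 := 4 * (n * n)%:R * c1.
have c20 : 0 <= c2 by rewrite /c2 /c1 !mulr_ge0 //; lra.
pose c3 := c2 * l1norm (sympJ R n) ^+ 2 * (2 * c + c2 * delta).
have c30 : 0 <= c3.
  apply: mulr_ge0; first by apply: mulr_ge0 => //; exact: sqr_ge0.
  by apply: addr_ge0; apply: mulr_ge0 => //; exact: ltW.
exists (1 + c2 + c3), (Num.min delta delta'); split; first by lra.
  by rewrite lt_min delta0.
move=> E e M; rewrite lt_min => /andP[smallE smallE'] emono hM.
have [Mc ent near] := Hc _ _ _ smallE hM.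
have E0 := l1norm_ge0 E.
have cE0 : 0 <= c * l1norm E by rewrite mulr_ge0 // ltW.
have cgE0 : 0 <= c / (g / 2) * l1norm E by rewrite mulr_ge0 // ltW.
have far i j x : d 0 i != d 0 j -> `|d 0 i - e 0 j| * `|x| <= c * l1norm E ->
    `|x| <= c1 * l1norm E.
  move=> dij hx; have := gap (i, j) dij; have := close _ _ _ smallE' emono hM j => /=.
  move=> cl ga; have ge : g / 2 <= `|d 0 i - e 0 j|.
    have := ler_distD (e 0 j) (d 0 i) (d 0 j); rewrite [`|e 0 j - _|]distrC; lra.
  rewrite /c1 mulrDl; apply: ler_wpDl => //.
  rewrite mulrAC ler_pdivlMr ?divr_gt0 // mulrC; apply: le_trans hx.
  exact: ler_wpM2r.
have near1 x : `|x| <= c * l1norm E -> `|x| <= c1 * l1norm E.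
  by move=> hx; apply: le_trans hx _; rewrite /c1 mulrDl lerDl.
have c1E0 : 0 <= c1 * l1norm E by rewrite /c1 mulrDl addr_ge0.
have small : l1norm (M - complex_truncation d M) <= c2 * l1norm E.
  rewrite -{1}[M]submxK /complex_truncation opp_block_mx add_block_mx l1norm_block.
  set N := (n * n)%:R * (c1 * l1norm E).
  have -> : c2 * l1norm E = N + N + N + N by rewrite /c2 /N; ring.
  apply: lerD; [apply: lerD; [apply: lerD|]|]; apply: l1norm_le => i j;
    have [e1 e2 e3 e4] := ent i j; have [n1 n2] := near i j;
    rewrite ![(_ + _ : 'M__) _ _]mxE ![(- _ : 'M__) _ _]mxE;
    rewrite ![(class_truncation _ _) _ _]mxE ?opprK.
  - case: eqVneq => dij; first by rewrite subrr normr0.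
    by rewrite subr0; apply: far dij e1.
  - case: eqVneq => dij; first by rewrite subrr normr0.
    by rewrite subr0; apply: far dij e2.
  - case: eqVneq => dij; first by rewrite addrC; apply: near1.
    by rewrite addr0; apply: far dij e3.
  - case: eqVneq => dij; first by rewrite distrC; apply: near1.
    by rewrite subr0; apply: far dij e4.
have c2E0 : 0 <= c2 * l1norm E by rewrite mulr_ge0.
have c3E0 : 0 <= c3 * l1norm E by rewrite mulr_ge0.
split; first by apply: le_trans small _; rewrite !mulrDl; lra.
have hS : symplectic_mx M by case: hM.
apply: le_trans (commuting_gram_le hS (complex_truncation_sympJ d M)) _.
apply: (@le_trans _ _ (c3 * l1norm E)); last by rewrite !mulrDl; lra.
have -> : c3 * l1norm E =
   c2 * l1norm E * l1norm (sympJ R n) ^+ 2 * (2 * c + c2 * delta) by rewrite /c3; ring.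
apply: ler_pM.
- by apply: mulr_ge0; [exact: l1norm_ge0|exact: sqr_ge0].
- by apply: addr_ge0; [apply: mulr_ge0 => //|]; exact: l1norm_ge0.
- by rewrite ler_wpM2r ?sqr_ge0.
apply: lerD; first by rewrite ler_wpM2l.
by apply: le_trans small _; rewrite ler_wpM2l // ltW.
Qed.

End Truncation.

(** * Symplectic direct sums *)

Section SympDsum.
Variable R : realType.

Lemma symp_dsumM m m' (T U : 'M[R]_(m + m)) (T' U' : 'M[R]_(m' + m')) :
  symp_dsum (T *m U) (T' *m U') = symp_dsum T T' *m symp_dsum U U'.
Proof.
rewrite -[T in LHS]submxK -[U in LHS]submxK -[T' in LHS]submxK -[U' in LHS]submxK.
rewrite /symp_dsum /dsum_mx !mulmx_block.
rewrite !block_mxKul !block_mxKur !block_mxKdl !block_mxKdr.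
rewrite !(mulmx0, mul0mx, add0r, addr0).
by rewrite !add_block_mx !addr0.
Qed.

Lemma symp_dsum_tr m m' (T : 'M[R]_(m + m)) (T' : 'M[R]_(m' + m')) :
  symp_dsum T^T T'^T = (symp_dsum T T')^T.
Proof.
rewrite /symp_dsum /dsum_mx !tr_block_mx !trmx0.
by rewrite -!trmx_ulsub -!trmx_ursub -!trmx_dlsub -!trmx_drsub.
Qed.

Lemma symp_dsumB m m' (T U : 'M[R]_(m + m)) (T' U' : 'M[R]_(m' + m')) :
  symp_dsum (T - U) (T' - U') = symp_dsum T T' - symp_dsum U U'.
Proof.
rewrite /symp_dsum /dsum_mx !opp_block_mx !add_block_mx !subr0.
by congr block_mx; congr block_mx; apply/matrixP => i j; rewrite !mxE.
Qed.

Lemma symp_dsum1 m m' :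
  symp_dsum (1%:M : 'M[R]_(m + m)) (1%:M : 'M_(m' + m')) = 1%:M.
Proof.
rewrite !scalar_mx_block /symp_dsum.
rewrite !block_mxKul !block_mxKur !block_mxKdl !block_mxKdr.
by rewrite /dsum_mx block_mx0 -!scalar_mx_block.
Qed.

Lemma symp_dsumJ m m' : symp_dsum (sympJ R m) (sympJ R m') = sympJ R (m + m').
Proof.
rewrite /sympJ /symp_dsum !block_mxKul !block_mxKur !block_mxKdl !block_mxKdr.
rewrite /dsum_mx block_mx0 -!scalar_mx_block; congr block_mx.
by rewrite (scalar_mx_block m m') opp_block_mx !oppr0.
Qed.

Lemma l1norm_symp_dsum m m' (T : 'M[R]_(m + m)) (T' : 'M[R]_(m' + m')) :
  l1norm (symp_dsum T T') = l1norm T + l1norm T'.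
Proof.
rewrite -{2}[T]submxK -{2}[T']submxK /symp_dsum /dsum_mx !l1norm_block !l1norm0.
ring.
Qed.

Lemma symp_dsum_orthosymplectic m m' (T : 'M[R]_(m + m)) (T' : 'M[R]_(m' + m')) :
  orthosymplectic_mx T -> orthosymplectic_mx T' -> orthosymplectic_mx (symp_dsum T T').
Proof.
move=> [oT sT] [oT' sT']; split; rewrite /symplectic_mx -symp_dsum_tr.
  by rewrite -symp_dsumM oT oT' symp_dsum1.
by rewrite -symp_dsumJ -!symp_dsumM sT sT'.
Qed.

Variables (I : Type) (m : I -> nat).
Implicit Types (T U : forall i, 'M[R]_(m i + m i)) (s : seq I).

(** Unlike [symp_dsum_seq], the size of this sum depends only on the sizes [m i],
    so sums of different families can be multiplied and compared. *)
Fixpoint dsum_fam T s : 'M[R]_(sumn (map m s) + sumn (map m s)) :=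
  if s is i :: s' then symp_dsum (T i) (dsum_fam T s') else 0.

Lemma dsum_famM T U s :
  dsum_fam (fun i => T i *m U i) s = dsum_fam T s *m dsum_fam U s.
Proof. by elim: s => [|i s /= ->]; rewrite ?mul0mx ?symp_dsumM. Qed.

Lemma dsum_famB T U s :
  dsum_fam (fun i => T i - U i) s = dsum_fam T s - dsum_fam U s.
Proof. by elim: s => [|i s /= ->]; rewrite ?subrr ?symp_dsumB. Qed.

Lemma dsum_fam_tr T s : dsum_fam (fun i => (T i)^T) s = (dsum_fam T s)^T.
Proof. by elim: s => [|i s /= ->]; rewrite ?trmx0 ?symp_dsum_tr. Qed.

Lemma dsum_fam1 s : dsum_fam (fun i => 1%:M) s = 1%:M.
Proof. by elim: s => [|i s /= ->]; rewrite ?symp_dsum1 //= [1%:M]flatmx0 flatmx0. Qed.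

Lemma dsum_fam_orthosymplectic T s :
  (forall i, orthosymplectic_mx (T i)) -> orthosymplectic_mx (dsum_fam T s).
Proof.
move=> hT; elim: s => [|i s IH] /=; last exact: symp_dsum_orthosymplectic.
by split; rewrite /symplectic_mx; apply/matrixP => -[].
Qed.

Lemma l1norm_dsum_fam T s : l1norm (dsum_fam T s) = \sum_(i <- s) l1norm (T i).
Proof.
elim: s => [|i s IH] /=; first by rewrite big_nil l1norm0.
by rewrite l1norm_symp_dsum big_cons IH.
Qed.

Lemma dsum_famE T s :
  existT (fun k => 'M[R]_(k + k)) _
    (symp_dsum_seq [seq existT (fun k => 'M[R]_(k + k)) (m i) (T i) | i <- s]) =
  existT (fun k => 'M[R]_(k + k)) _ (dsum_fam T s).
Proof.
elim: s => //= i s IH.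
pose f (V : {k : nat & 'M[R]_(k + k)}) : {k : nat & 'M[R]_(k + k)} :=
  existT _ (m i + tag V)%N (symp_dsum (T i) (tagged V)).
exact: (congr1 f IH).
Qed.

(** The principal k-window at offset [o] of a matrix of four blocks, given by its
    entries: [F a b i j] is entry (i, j) of the block in row [a], column [b].
    Entries indexed by [nat] spare any cast between sizes. *)
Definition window (F : bool -> bool -> nat -> nat -> R) (k o : nat) : 'M[R]_(k + k) :=
  block_mx (\matrix_(i, j) F false false (o + i)%N (o + j)%N)
           (\matrix_(i, j) F false true (o + i)%N (o + j)%N)
           (\matrix_(i, j) F true false (o + i)%N (o + j)%N)
           (\matrix_(i, j) F true true (o + i)%N (o + j)%N).

Lemma symp_dsum_window F k k' o :
  (forall a b i j, (i < o + k <= j)%N -> F a b i j = 0 /\ F a b j i = 0) ->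
  symp_dsum (window F k o) (window F k' (o + k)) = window F (k + k') o.
Proof.
move=> F0; rewrite /symp_dsum /window.
rewrite !block_mxKul !block_mxKur !block_mxKdl !block_mxKdr.
have blk a b : dsum_mx (\matrix_(i < k, j < k) F a b (o + i)%N (o + j)%N)
    (\matrix_(i < k', j < k') F a b (o + k + i)%N (o + k + j)%N) =
    \matrix_(i, j) F a b (o + i)%N (o + j)%N.
  apply/matrixP => i j; rewrite /dsum_mx [RHS]mxE.
  case: (split_ordP i) => i' ->; case: (split_ordP j) => j' ->;
   rewrite ?block_mxEul ?block_mxEur ?block_mxEdl ?block_mxEdr !mxE /= ?addnA //.
  - have [] // := F0 a b (o + i')%N (o + k + j')%N.
    by rewrite ltn_add2l ltn_ord leq_addr.
  - have [] // := F0 a b (o + j')%N (o + k + i')%N.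
    by rewrite ltn_add2l ltn_ord leq_addr.
by rewrite !blk.
Qed.

Variable off : I -> nat.

Fixpoint consecutive (o : nat) s : bool :=
  if s is i :: s' then (off i == o) && consecutive (o + m i) s' else true.

Lemma dsum_fam_window F s o : consecutive o s ->
  (forall k a b i j, (i < off k + m k <= j)%N -> F a b i j = 0 /\ F a b j i = 0) ->
  dsum_fam (fun i => window F (m i) (off i)) s = window F (sumn (map m s)) o.
Proof.
move=> + F0; elim: s o => [|i s IH] o /=; first by move=> _; apply/matrixP => -[].
by case/andP => /eqP <- /IH ->; apply: symp_dsum_window (F0 i).
Qed.

End SympDsum.

(** The bridge to the cast in [symp_block_dsum], whose two sizes are q + q and
    N + N: an equality of dependent pairs provides q = k, which the cast hides. *)
Lemma castmx_Tagged (R : realType) q k N (P : 'M[R]_(q + q)) (V : 'M[R]_(k + k))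
    (e : k = N) (e' : (q + q = N + N)%N) :
  existT (fun k => 'M[R]_(k + k)) q P = existT (fun k => 'M[R]_(k + k)) k V ->
  castmx (e', e') P = ecast k ('M[R]_(k + k)) e V.
Proof.
case: N / e e' => /= e' PV; have qk := congr1 tag PV; rewrite /= in qk.
case: k / qk V e' PV => V e' PV; rewrite castmx_id.
exact: (eq_from_Tagged (T_ := fun k => 'M[R]_(k + k))) PV.
Qed.

Section Ecast.
Variables (R : realType) (k N : nat) (e : k = N).
Local Notation cast := (fun V => ecast k ('M[R]_(k + k)) e V).

Lemma ecast_window F o : cast (window F k o) = window F N o.
Proof. by case: N / e. Qed.

Lemma ecast_orthosymplectic V : orthosymplectic_mx V -> orthosymplectic_mx (cast V).
Proof. by case: N / e. Qed.

Lemma l1norm_ecastB V U : l1norm (cast V - cast U) = l1norm (V - U).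
Proof. by case: N / e. Qed.

Lemma l1norm_ecast_gram V :
  l1norm ((cast V)^T *m cast V - 1%:M) = l1norm (V^T *m V - 1%:M).
Proof. by case: N / e. Qed.

End Ecast.

(** * Index sets as consecutive intervals *)

Section IndexSets.
Variables (R : realType) (n : nat) (A : 'M[R]_(n + n)).
Hypothesis eigs_mono :
  forall j k : 'I_n, (j <= k)%N -> symp_eigs A 0 j <= symp_eigs A 0 k.
Let r := num_symp_eigs A.
Let fam := forall i : 'I_r, 'M[R]_(#|index_set i| + #|index_set i|).
Let m (i : 'I_r) := #|index_set i|.

Lemma sumn_card_index_set : sumn [seq m i | i <- enum 'I_r] = n.
Proof. by rewrite sumnE big_map big_enum /= sum_card_index_set. Qed.

Lemma symp_block_dsumE (T : fam) :
  symp_block_dsum T =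
  ecast k ('M[R]_(k + k)) sumn_card_index_set (dsum_fam T (enum 'I_r)).
Proof. by apply: castmx_Tagged; exact: dsum_famE. Qed.

Lemma symp_block_dsum_orthosymplectic (T : fam) :
  (forall i, orthosymplectic_mx (T i)) -> orthosymplectic_mx (symp_block_dsum T).
Proof.
move=> hT; rewrite symp_block_dsumE; apply: ecast_orthosymplectic.
exact: dsum_fam_orthosymplectic.
Qed.

Lemma l1norm_symp_block_dsumB (T U : fam) :
  l1norm (symp_block_dsum T - symp_block_dsum U) = \sum_i l1norm (T i - U i).
Proof.
rewrite !symp_block_dsumE l1norm_ecastB.
by rewrite -dsum_famB l1norm_dsum_fam big_enum.
Qed.

Lemma l1norm_symp_block_dsum_gram (T : fam) :
  l1norm ((symp_block_dsum T)^T *m symp_block_dsum T - 1%:M) =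
  \sum_i l1norm ((T i)^T *m T i - 1%:M).
Proof.
rewrite symp_block_dsumE l1norm_ecast_gram.
by rewrite -dsum_fam_tr -dsum_famM -(dsum_fam1 R m) -dsum_famB l1norm_dsum_fam big_enum.
Qed.

Let mu (i : 'I_r) : R := (distinct_symp_eigs A)`_i.

Lemma distinct_symp_eigs_mono (i k : 'I_r) : (mu i <= mu k) = (i <= k)%N.
Proof.
apply: lt_sorted_leq_nth; rewrite ?inE ?ltn_ord //.
by rewrite sort_lt_sorted undup_uniq.
Qed.

Lemma symp_eigs_distinct j : exists l : 'I_r, symp_eigs A 0 j = mu l.
Proof.
have memD : symp_eigs A 0 j \in distinct_symp_eigs A.
  by rewrite mem_sort mem_undup map_f // mem_enum.
have lt_r : (index (symp_eigs A 0%R j) (distinct_symp_eigs A) < r)%N.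
  by rewrite index_mem.
by exists (Ordinal lt_r); rewrite /mu /= nth_index.
Qed.

(** As the eigenvalues are sorted, index set i consists of the #|index_set i|
    positions from this one on; see [index_offset_le]. *)
Definition index_offset (i : 'I_r) : nat :=
  #|[set j | symp_eigs A 0 j < mu i]%SET|.

Lemma index_offsetS i :
  (index_offset i + m i)%N = #|[set j | symp_eigs A 0 j <= mu i]%SET|.
Proof.
rewrite -cardsUI [X in (_ + X)%N](_ : _ = 0%N) ?addn0.
  by congr #|pred_of_set _|; apply/setP => j; rewrite !inE le_eqVlt orbC.
apply/eqP; rewrite cards_eq0; apply/eqP/setP => j; rewrite !inE.
by apply/negP => /andP[lt_mu /eqP dj]; rewrite dj ltxx in lt_mu.
Qed.

Lemma down_set_mem (S : {set 'I_n}) :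
  (forall j k : 'I_n, (j <= k)%N -> k \in S -> j \in S) ->
  forall j : 'I_n, (j \in S) = (j < #|S|)%N.
Proof.
have card_lt k : (k <= n)%N -> #|[set l : 'I_n | (l < k)%N]%SET| = k.
  move=> kn; rewrite -sum1dep_card -[RHS]card_ord -sum1_card.
  by rewrite (big_ord_widen n (fun=> 1%N) kn).
move=> down j; apply/idP/idP => [jS|].
  rewrite -[X in (X <= _)%N](card_lt j.+1) //; apply/subset_leq_card/fintype.subsetP => l.
  by rewrite inE ltnS => lj; exact: down lj jS.
apply: contraLR => jS; rewrite -leqNgt -[X in (_ <= X)%N](card_lt j (ltnW (ltn_ord j))).
apply/subset_leq_card/fintype.subsetP => l lS; rewrite inE ltnNge.
by apply: contra jS => jl; exact: down jl lS.
Qed.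

Lemma index_offset_le i j : (symp_eigs A 0 j <= mu i) = (j < index_offset i + m i)%N.
Proof.
rewrite index_offsetS -down_set_mem ?inE // => k l kl; rewrite !inE.
exact: le_trans (eigs_mono kl).
Qed.

Lemma consecutive_index_offset : consecutive m index_offset 0 (enum 'I_r).
Proof.
have consec i s : path (fun k l : 'I_r => l == k.+1 :> nat) i s ->
    consecutive m index_offset (index_offset i) (i :: s).
  elim: s i => [|k s IH] i /=; rewrite eqxx //= => /andP[/eqP ki /IH /=].
  suff -> : index_offset k = (index_offset i + m i)%N by [].
  rewrite index_offsetS; congr #|pred_of_set _|; apply/setP => j; rewrite !inE.
  have [l ->] := symp_eigs_distinct j.
  by rewrite ltNge !distinct_symp_eigs_mono -ltnNge ki ltnS.
have iota_path a b : path (fun k l => l == k.+1) a (iota a.+1 b).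
  by elim: b a => //= b IH a; rewrite eqxx IH.
have : sorted (fun k l => l == k.+1) (map val (enum 'I_r)).
  by rewrite val_enum_ord; case: r => //= r'; exact: iota_path.
rewrite sorted_map; case E : (enum 'I_r) => [|i s] //= /consec /=.
suff -> : index_offset i = 0%N by [].
apply/eqP; rewrite cards_eq0; apply/eqP/setP => j; rewrite !inE ltNge.
have [l ->] := symp_eigs_distinct j; rewrite distinct_symp_eigs_mono.
suff -> : i = 0%N :> nat by [].
have <- : head 0%N (map val (enum 'I_r)) = i by rewrite E.
by rewrite val_enum_ord; case: (r).
Qed.

(** Sorting makes each index set an interval, so that not mixing different
    eigenvalues is the same as being block diagonal; the windows over these
    intervals inherit the pattern W, X, -X, W. *)
Lemma class_block_decomposition (W X : 'M[R]_n) :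
  (forall i j, symp_eigs A 0 i != symp_eigs A 0 j -> W i j = 0 /\ X i j = 0) ->
  exists WX : forall i : 'I_r, 'M[R]_(m i) * 'M[R]_(m i),
    symp_block_dsum (fun i => block_mx (WX i).1 (WX i).2 (- (WX i).2) (WX i).1) =
    block_mx W X (- X) W.
Proof.
move=> WX0.
pose ent (V : 'M[R]_n) (p q : nat) : R :=
  if insub p is Some i then if insub q is Some j then V i j else 0 else 0.
have ent_ord V (i j : 'I_n) : ent V i j = V i j by rewrite /ent !valK.
pose F (a b : bool) p q :=
  if a == b then ent W p q else if a then - ent X p q else ent X p q.
exists (fun i => (\matrix_(p, q) ent W (index_offset i + p) (index_offset i + q),
   \matrix_(p, q) ent X (index_offset i + p) (index_offset i + q)))%N.
have ent0 (i j : nat) k :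
    (i < index_offset k + m k <= j)%N \/ (j < index_offset k + m k <= i)%N ->
    ent W i j = 0 /\ ent X i j = 0.
  move=> ij; rewrite /ent; case: insubP => // i' _ iE; case: insubP => // j' _ jE.
  apply: WX0; apply/eqP => dE.
  have := index_offset_le k i'; rewrite dE index_offset_le iE jE => ij_iff.
  by case: ij => /andP[lt_off]; rewrite leqNgt;
    [rewrite ij_iff lt_off|rewrite -ij_iff lt_off].
transitivity (symp_block_dsum (fun i => window F (m i) (index_offset i))).
  congr symp_block_dsum; apply: functional_extensionality_dep => i /=.
  rewrite /window /F /=; congr block_mx; by apply/matrixP => p q; rewrite !mxE.
rewrite symp_block_dsumE (dsum_fam_window consecutive_index_offset).
  rewrite ecast_window /window /F /=; congr block_mx;
    by apply/matrixP => p q; rewrite !mxE !add0n ent_ord.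
move=> k a b i j ij; have [W1 X1] := ent0 i j k (or_introl ij).
have [W2 X2] := ent0 j i k (or_intror ij).
by rewrite /F; case: a b => -[] /=; rewrite ?W1 ?W2 ?X1 ?X2 ?oppr0.
Qed.

End IndexSets.

(** * The theorem *)

(** The existence of one diagonalizing [S] replaces Williamson's theorem: if
    [symp_eigs A] were the default value 0 then S^T A S = 0, absurd for positive
    definite [A] unless n = 0, when the conditions are void. *)
Lemma symp_eigs_williamson (R : realType) n (A S : 'M[R]_(n + n)) :
  posdef_mx A -> diagonalizing_symp A S -> williamson_diag A (symp_eigs A).
Proof.
move=> [_ pos] hS; have : symp_eigs A = 0 \/ williamson_diag A (symp_eigs A).
  by rewrite /symp_eigs; case: xgetP => [d -> ?|]; [right|left].
case=> // d0; case: hS; rewrite d0 => sS dS.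
have absurd (j : 'I_n) : False.
  have uS := symplectic_unitmx sS.
  have /pos := col_unitmx_neq0 (lshift n j) uS.
  rewrite (_ : (_ *m _) 0 0 = (S^T *m A *m S) (lshift n j) (lshift n j)).
    by rewrite dS /dsum_mx block_mxEul !mxE mul0rn ltxx.
  rewrite [LHS]mxE [RHS]mxE; apply: eq_bigr => k _; rewrite !mxE; congr (_ * _).
  by apply: eq_bigr => l _; rewrite !mxE.
by split=> [j|j|]; [case: (absurd j)|case: (absurd j)|exists S].
Qed.

Lemma orthosymplectic1 (R : realType) m : orthosymplectic_mx (1%:M : 'M[R]_(m + m)).
Proof. by split; rewrite /symplectic_mx trmx1 ?mulmx1 ?mul1mx. Qed.

(** The Gram defect of a symplectic direct sum is the sum of those of its summands,
    so [near_orthosymplectic] applies to each summand, and replacing every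
    summand costs the sum of the errors. *)
Lemma block_orthosymplectic_approx (R : realType) n (A : 'M[R]_(n + n)) (W X : 'M[R]_n)
    (G := block_mx W X (- X) W) :
  (forall j k : 'I_n, (j <= k)%N -> symp_eigs A 0 j <= symp_eigs A 0 k) ->
  (forall i j, symp_eigs A 0 i != symp_eigs A 0 j -> W i j = 0 /\ X i j = 0) ->
  (n * n)%:R ^+ 2 * l1norm (G^T *m G - 1%:M) < 1 ->
  exists Qb : forall i : 'I_(num_symp_eigs A),
      'M[R]_(#|index_set i| + #|index_set i|),
    (forall i, orthosymplectic_mx (Qb i)) /\
    l1norm (G - symp_block_dsum Qb) <=
      (num_symp_eigs A)%:R * (4 * (n * n)%:R ^+ 5) * l1norm (G^T *m G - 1%:M).
Proof.
move=> mono supp small; have [WX GE] := class_block_decomposition mono supp.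
pose T i := block_mx (WX i).1 (WX i).2 (- (WX i).2) (WX i).1.
rewrite -/T in GE; rewrite /G -GE in small *.
set g := l1norm (_^T *m _ - _) in small *.
have g0 : 0 <= g := l1norm_ge0 _.
have gT i : l1norm ((T i)^T *m T i - 1%:M) <= g.
  rewrite /g l1norm_symp_block_dsum_gram (bigD1 i) //= lerDl sumr_ge0 // => k _.
  exact: l1norm_ge0.
have card_le (i : 'I_(num_symp_eigs A)) :
    (#|index_set i| * #|index_set i|)%:R <= (n * n)%:R :> R.
  by rewrite ler_nat leq_mul // -[leqRHS]card_ord max_card.
have near i : exists Q : 'M[R]_(#|index_set i| + #|index_set i|),
    orthosymplectic_mx Q /\ l1norm (T i - Q) <= 4 * (n * n)%:R ^+ 5 * g.
  have [|Q [oQ nQ]] := @near_orthosymplectic _ _ (WX i).1 (WX i).2.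
    apply: le_lt_trans small; apply: ler_pM => //; rewrite ?exprn_ge0 ?l1norm_ge0 //.
    by rewrite lerXn2r ?nnegrE.
  exists Q; split=> //; apply: le_trans nQ _.
  apply: ler_pM => //; rewrite ?l1norm_ge0 ?mulr_ge0 ?exprn_ge0 //.
  by rewrite ler_pM2l // lerXn2r ?nnegrE.
have [Qb hQb] : exists Qb : forall i : 'I_(num_symp_eigs A),
      'M[R]_(#|index_set i| + #|index_set i|),
    forall i, orthosymplectic_mx (Qb i) /\
      l1norm (T i - Qb i) <= 4 * (n * n)%:R ^+ 5 * g.
  by exists (fun i => projT1 (cid (near i))) => i; exact: projT2 (cid (near i)).
exists Qb; split=> [i|]; first by case: (hQb i).
rewrite l1norm_symp_block_dsumB -mulrA mulr_natl -[X in _ *+ X]card_ord -sumr_const.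
by apply: ler_sum => i _; case: (hQb i).
Qed.

Theorem theorem6 (R : realType) (n : nat) (A S : 'M[R]_(n + n))
    (hA : posdef_mx A) (hS : diagonalizing_symp A S) :
  exists c delta : R, 0 < c /\ 0 < delta /\
    forall H St : 'M[R]_(n + n),
      H^T = H -> posdef_mx (A + H) -> diagonalizing_symp (A + H) St ->
      exists Q : 'M[R]_(n + n), orthosymplectic_mx Q /\
        (exists Qb : forall i : 'I_(num_symp_eigs A),
             'M[R]_(#|index_set i| + #|index_set i|),
           (forall i, orthosymplectic_mx (Qb i)) /\ Q = symp_block_dsum Qb) /\
        (spectral_norm H < delta ->
           spectral_norm (St - S *m Q) <= c * spectral_norm H).
Proof.
have [d0 dmono _] := symp_eigs_williamson hA hS.
set d := symp_eigs A in d0 dmono.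
have [sS dS] := hS; have uS := symplectic_unitmx sS.
have [c [delta [c0 delta0 Hc]]] := perturbed_truncation d0 dmono.
pose a : R := ((n + n) * (n + n))%:R * (n + n)%:R.
pose b := 1 + l1norm S ^+ 2 * a.
have b0 : 0 < b by rewrite ltr_wpDr // mulr_ge0 ?sqr_ge0 // /a -natrM.
pose k : R := (n * n)%:R ^+ 2 + 1.
have k0 : 0 < k by rewrite ltr_wpDl // exprn_ge0.
pose r : R := (num_symp_eigs A)%:R * (4 * (n * n)%:R ^+ 5).
have r0 : 0 <= r by rewrite !mulr_ge0 // exprn_ge0.
pose C := l1norm S * ((1 + r) * c * b).
have C0 : 0 <= C.
  have rcb0 : 0 < (1 + r) * c * b by rewrite !mulr_gt0 // ltr_wpDr.
  by apply: mulr_ge0; [exact: l1norm_ge0|exact: ltW].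
have kc0 : 0 < k * c by rewrite mulr_gt0.
pose D : R := Num.min (delta / b) (1 / (k * c) / b).
exists (1 + C), D.
split; first by rewrite ltr_wpDr.
split; first by rewrite lt_min !divr_gt0.
move=> H St HT hAH hSt.
have [smallH|largeH] := boolP (spectral_norm H < D); last first.
  (* nothing is claimed about the distance for large H: take Q = 1 blockwise *)
  exists (symp_block_dsum
    (fun i => 1%:M : 'M[R]_(#|@index_set R n A i| + #|index_set i|))).
  split; first by apply: symp_block_dsum_orthosymplectic => i; exact: orthosymplectic1.
  split; last by move=> smallH; case/negP: largeH.
  by exists (fun=> 1%:M); split=> // i; exact: orthosymplectic1.
move: (smallH); rewrite lt_min !ltr_pdivlMr // => /andP[small1 small2].
have H0 := spectral_norm_ge0 H.
pose E := S^T *m H *m S.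
have nE : l1norm E <= b * spectral_norm H.
  apply: (@le_trans _ _ (l1norm S ^+ 2 * l1norm H)).
    rewrite expr2 mulrAC; apply: l1norm_mul_le => //.
    by apply: l1norm_mul_le; rewrite ?l1norm_tr.
  rewrite /b mulrDl mul1r; apply: ler_wpDl => //.
  rewrite -mulrA ler_wpM2l ?sqr_ge0 //.
  by apply: le_trans (l1norm_le_spectral_norm H) _; rewrite mulrA.
have smallE : l1norm E < delta by apply: le_lt_trans nE _; rewrite mulrC.
pose M := invmx S *m St.
have [sSt dSt] := hSt.
have [e0 emono _] := symp_eigs_williamson hAH hSt.
have hM : diagonalizes_perturbation d E (symp_eigs (A + H)) M.
  split=> //; first exact: symplecticM (symplecticV sS) sSt.
  rewrite /doubled_diag -dSt -dS /E -mulmxDl -mulmxDr /M trmx_mul !mulmxA.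
  rewrite -[St^T *m _ *m S^T]mulmxA -trmx_mul mulmxV // trmx1 mulmx1.
  by rewrite -[_ *m S *m invmx S]mulmxA mulmxV // mulmx1.
have [MG gramG] := Hc _ _ _ smallE emono hM.
set G := complex_truncation d M in MG gramG.
have [|||Qb [oQb nQ]] := @block_orthosymplectic_approx R n A
   (class_truncation d (ulsubmx M)) (class_truncation d (ursubmx M)).
- exact: dmono.
- by move=> i j; rewrite !mxE -/d => /negbTE ->.
- rewrite -/G; apply: (@le_lt_trans _ _ (k * (c * l1norm E))).
    apply: ler_pM; rewrite ?exprn_ge0 ?l1norm_ge0 //.
    by rewrite /k lerDl.
  rewrite mulrA; apply: le_lt_trans (_ : k * c * (b * spectral_norm H) < 1).
    by rewrite ler_pM2l.
  by rewrite mulrC [b * _]mulrC.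
rewrite -/G in nQ.
exists (symp_block_dsum Qb); split; first exact: symp_block_dsum_orthosymplectic.
split; first by exists Qb.
move=> _; apply: le_trans (spectral_norm_le _) _.
have -> : St - S *m symp_block_dsum Qb =
    S *m ((M - G) + (G - symp_block_dsum Qb)).
  by rewrite addrA subrK mulmxBr /M mulmxA mulmxV // mul1mx.
apply: (@le_trans _ _ (C * spectral_norm H)); last first.
  by rewrite mulrDl mul1r lerDr.
have -> : C * spectral_norm H = l1norm S * ((1 + r) * c * (b * spectral_norm H)).
  by rewrite /C; ring.
apply: l1norm_mul_le => //; apply: le_trans (l1normD _ _) _.
apply: (@le_trans _ _ ((1 + r) * c * l1norm E)); last first.
  by apply: ler_wpM2l => //; apply: mulr_ge0; [exact: addr_ge0|exact: ltW].
rewrite -mulrA mulrDl mul1r; apply: lerD => //; apply: le_trans nQ _.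
by rewrite -/r ler_wpM2l.
Qed.
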